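(* Let $X$ be a complex projective variety and let $D$ be an effective Cartier divisor on $X$. If $(X,D)$ is a Nevanlinna pair, then $X\setminus D$ is Brody hyperbolic, i.e. every holomorphic map $\mathbb{C}\to X\setminus D$ is constant.
   Context: Parabolic Riemann surface: an open (non-compact) Riemann surface $Y$ together with a proper continuous function $\sigma:Y\to[0,\infty)$ (parabolic exhaustion function) such that $\log\sigma$ is harmonic outside possibly a finite set $\{P_1,\dots,P_k\}\subset Y$, and at each $P_i$, in a coordinate chart $(U,z)$ centered at $P_i$ not containing the other $P_j$, $\log\sigma(z)=k_i\log|z|+h_{P_i}(z)$ with $k_i$ a constant and $h_{P_i}$ harmonic on $U$. Notation: $d^c=\frac{\sqrt{-1}}{4\pi}(\bar\partial-\partial)$; $B(r)=\{\sigma<r\}$, $S(r)=\{\sigma=r\}$; for almost every $r$, $S(r)$ is smooth and $d\mu_r:=d^c\log\sigma|_{S(r)}$. The number $\varsigma:=\int_{S(r)}d\mu_r$ is independent of $r$ for $r$ large. $\chi_\sigma(r)$ is the Euler characteristic of $B(r)$ and $\mathfrak{X}_\sigma(r):=\int_1^r\chi_\sigma(t)\frac{dt}{t}$. On each $Y$ one fixes a nowhere vanishing global holomorphic vector field $\xi$, and $\mathfrak{E}_\sigma(r):=\int_{S(r)}\log^-|d\sigma(\xi)|^2\,d\mu_r$, where $\log^-x=-\min\{0,\log x\}$. On $Y=\mathbb{C}$ with $\sigma(z)=|z|$ one takes $\xi=\partial/\partial z$. For a holomorphic map $f:Y\to X$ with $f(Y)\not\subset D$ and a positive $(1,1)$-form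 $\eta$ on $X$: $T_{f,\eta}(r)=\int_1^r\left(\int_{B(t)}f^*\eta\right)\frac{dt}{t}$ and $\overline N_f(r,D)=\int_1^r\bar n_{f,D}(t)\frac{dt}{t}$, where $\bar n_{f,D}(t)$ is the number of points (without multiplicity) of $f^{-1}(D)$ in $B(t)$. Nevanlinna pair: $(X,D)$ is a Nevanlinna pair if there is a positive $(1,1)$-form $\eta$ on $X$ such that for any parabolic Riemann surface $Y$, every holomorphic map $f:Y\to X$ with $f(Y)\not\subset D$ and every $\delta>0$, $$T_{f,\eta}(r)\leq_{\mathrm{exc}}\overline N_f(r,D)-\mathfrak{X}_\sigma(r)+(\delta+2\varsigma)\log r+\mathfrak{E}_\sigma(r)+O(1),$$ where $O(1)$ may depend on $f$ and $Y$, and $\leq_{\mathrm{exc}}$ means that the inequality holds for all $r\in(0,\infty)$ except a set of finite measure depending on $\delta$. *)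

(* Defs.v *)
From HB Require Import structures.
From mathcomp Require Import all_boot all_order all_algebra.
From mathcomp Require Import all_classical all_reals all_analysis.
From mathcomp Require Import complex.
(* The notations of mpoly clash with those of analysis. *)
From mathcomp Require Import -(notations) mpoly.
Import numFieldNormedType.Exports.
Import Order.TTheory GRing.Theory Num.Theory.

Set Implicit Arguments.
Unset Strict Implicit.
Unset Printing Implicit Defensive.

Local Open Scope classical_set_scope.
Local Open Scope complex_scope.
Local Open Scope ring_scope.

(* The complex numbers, with the topology given by the modulus; the regular
   module R[i]^o is the form of R[i] that carries the normed structure. *)
Notation CC R := (R[i]^o).

Definition modulus (R : realType) (z : CC R) : R := ComplexField.Normc.normc z.

(* Meant for open U: f is complex differentiable at every point of U. *)
Definition holomorphic_on (R : realType) (U : set (CC R)) (f : CC R -> CC R) :=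
  forall z, U z -> derivable f z 1.

Definition rderiv (R : realType) (V : normedModType R[i]) (a : V) (u : V -> R)
    (v : V) : R :=
  derive1 (fun t : R => u (v + t%:C *: a)) 0.

(* u is of class C^k in the real sense on the open set W: all the iterated
   directional derivatives of order at most k exist and are continuous. *)
Fixpoint class_C (R : realType) (V : normedModType R[i]) (k : nat) (W : set V)
    (u : V -> R) : Prop :=
  (forall v, W v -> {for v, continuous u}) /\
  (if k is k'.+1 then
     forall a : V,
       (forall v, W v -> derivable (fun t : R => u (v + t%:C *: a)) 0 1) /\
       class_C k' W (rderiv a u)
   else True).

Definition smooth_on (R : realType) (V : normedModType R[i]) (W : set V)
    (u : V -> R) :=
  forall k, class_C k W u.

Definition d_dx (R : realType) (u : CC R -> R) : CC R -> R :=
  rderiv (1 : CC R) u.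
Definition d_dy (R : realType) (u : CC R -> R) : CC R -> R :=
  rderiv ((0 +i* 1) : CC R) u.

Definition harmonic_on (R : realType) (U : set (CC R)) (u : CC R -> R) :=
  class_C 2 U u /\
  forall z, U z -> d_dx (d_dx u) z + d_dy (d_dy u) z = 0.

(* A chart is a partial homeomorphism: only the values of [cmap] on [cdom] and
   of [cinv] on the image of [cdom] matter. *)
Record chart (R : realType) (T : topologicalType) := Chart {
  cdom : set T;
  cmap : T -> CC R;
  cinv : CC R -> T }.

Definition is_chart (R : realType) (T : topologicalType) (c : chart R T) :=
  [/\ open (cdom c), open (cmap c @` cdom c),
      forall y, cdom c y -> cinv c (cmap c y) = y &
      {within cdom c, continuous (cmap c)} /\
      {within cmap c @` cdom c, continuous (cinv c)}].

(* The atlas is indexed by the points of the surface, the chart [rs_chart p]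
   being defined around p; so every point carries a preferred chart. *)
Record riemann_surface (R : realType) := RiemannSurface {
  rs_space :> topologicalType;
  rs_chart : rs_space -> chart R rs_space;
  rs_nonempty : [set: rs_space] !=set0;
  rs_hausdorff : hausdorff_space rs_space;
  rs_connected : connected [set: rs_space];
  rs_chartP : forall p, is_chart (rs_chart p);
  rs_center : forall p, cdom (rs_chart p) p;
  rs_transition : forall p q,
    holomorphic_on
      (cmap (rs_chart p) @` (cdom (rs_chart p) `&` cdom (rs_chart q)))
      (cmap (rs_chart q) \o cinv (rs_chart p)) }.

Section Surface.
Context {R : realType} (Y : riemann_surface R).

Definition in_chart (p : Y) (A : set Y) : set (CC R) :=
  cmap (rs_chart p) @` (cdom (rs_chart p) `&` A).

Definition coord (p : Y) : Y -> CC R := cmap (rs_chart p).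
Definition param (p : Y) : CC R -> Y := cinv (rs_chart p).

(* A (1,0)-vector field xi is given by its component in the preferred chart at
   each point y, i.e. the value at y is xi y * d/dz for z = coord y; the
   component at y in the chart at p is obtained by the chain rule. *)
Definition holomorphic_field (xi : Y -> CC R) :=
  forall p, holomorphic_on (in_chart p setT)
    (fun z => let y := param p z in
       derive1 (coord p \o param y : CC R -> CC R) (coord y y) * xi y).

Definition parabolic_exhaustion (sigma : Y -> R) :=
  [/\ continuous sigma,
      forall y, 0 <= sigma y,
      forall K : set R, compact K -> compact (sigma @^-1` K) &
      exists P : set Y, [/\ finite_set P,
        forall y, ~ P y -> 0 < sigma y,
        forall q, harmonic_on (in_chart q (~` P))
                    (fun z => ln (sigma (param q z))) &
        forall p, P p -> exists U : set Y,
          [/\ open U, U `<=` cdom (rs_chart p), U `&` P = [set p] &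
          exists (k : R) (h : CC R -> R), harmonic_on (in_chart p U) h /\
            forall y, U y -> y <> p ->
              ln (sigma y) =
                k * ln (modulus (coord p y - coord p p)) + h (coord p y)]]].

Definition parabolic_surface (sigma : Y -> R) :=
  ~ compact [set: Y] /\ parabolic_exhaustion sigma.

Definition sublevel (sigma : Y -> R) (r : R) : set Y := [set y | sigma y < r].
Definition level (sigma : Y -> R) (r : R) : set Y := [set y | sigma y = r].

(* (x, y) : [0, 1] -> C is a C^1 curve, injective on ]0, 1[, whose restriction
   to ]0, 1[ is the expression in the chart at p of an arc drawn in A *)
Definition is_arc (A : set Y) (p : Y) (x y : R -> R) :=
  [/\ forall t : R, 0 <= t <= 1 -> derivable x t 1 /\ derivable y t 1,
      {within `[0, 1], continuous (derive1 x)},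
      {within `[0, 1], continuous (derive1 y)},
      (forall s t : R, 0 < s < 1 -> 0 < t < 1 ->
         (x s, y s) = (x t, y t) -> s = t) &
      forall t : R, 0 < t < 1 -> in_chart p A (x t +i* y t)].

Definition arc_image (p : Y) (x y : R -> R) : set Y :=
  [set param p (x t +i* y t) | t in `]0, 1[].

(* d^c u evaluated on the velocity of the curve (x, y) at time t: since
   d^c = (i / 4 pi) (dbar - d), d^c u = (u_x dy - u_y dx) / (4 pi). *)
Definition dc_along (u : CC R -> R) (x y : R -> R) (t : R) : R :=
  (d_dx u (x t +i* y t) * derive1 y t - d_dy u (x t +i* y t) * derive1 x t)
  / (4 * pi).

(* The integral over S(r) of g dmu_r, for g >= 0.  S(r) is oriented as the
   boundary of B(r), so that d^c log sigma induces a nonnegative measure on it,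
   whence the absolute value; the integral is the supremum of the integrals
   over finite families of disjoint arcs drawn on S(r), each one contained in
   a chart. *)
Definition level_integral (sigma : Y -> R) (g : Y -> R) (r : R) : \bar R :=
  ereal_sup [set s | exists n (p : 'I_n -> Y) (x y : 'I_n -> R -> R),
    [/\ forall j, is_arc (level sigma r) (p j) (x j) (y j),
        trivIset setT (fun j => arc_image (p j) (x j) (y j)) &
        s = (\sum_(j < n) \int[@lebesgue_measure R]_(t in `]0%R, 1%R[)
              (g (param (p j) (x j t +i* y j t)) *
               `|dc_along (fun z => ln (sigma (param (p j) z))) (x j) (y j) t|
              )%:E)%E]].

(* The integral of dmu_r is constant for r large: this is its value. *)
Definition varsigma (sigma : Y -> R) : R :=
  fine (lim (level_integral sigma (fun=> 1) r @[r --> +oo%R])).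

(* With the convention ln 0 = 0, log_minus 0 is 0 instead of +oo; in the integral
   below this only concerns the critical points of sigma, where the density of
   dmu_r vanishes. *)
Definition log_minus (x : R) : R := - Num.min 0 (ln x).

(* d sigma (xi) = xi^z (d sigma / dz), with d/dz = (d/dx - i d/dy) / 2 *)
Definition dsigma_xi (sigma : Y -> R) (xi : Y -> CC R) (y : Y) : CC R :=
  let s := sigma \o param y in
  xi y * ((d_dx s (coord y y) / 2) +i* (- d_dy s (coord y y) / 2)).

Definition E_sigma (sigma : Y -> R) (xi : Y -> CC R) (r : R) : \bar R :=
  level_integral sigma
    (fun y => log_minus (modulus (dsigma_xi sigma xi y) ^+ 2)) r.

End Surface.

Section Homology.
Context {R : realType} {T : topologicalType}.

Definition std_simplex n : set 'rV[R]_n.+1 :=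
  [set v | (forall i, 0 <= v ord0 i) /\ \sum_i v ord0 i = 1].

Definition face_map n (i : 'I_n.+2) (v : 'rV[R]_n.+1) : 'rV[R]_n.+2 :=
  \row_j (if unlift i j is Some k then v ord0 k else 0).

(* Formal combinations of singular simplices.  Simplices are represented by
   functions on R^(n+1), of which only the restriction to the standard simplex
   is relevant, so two chains are identified when they have the same
   coefficients in the sense of [coef]. *)
Definition chain n := seq (rat * ('rV[R]_n.+1 -> T)).

Definition same_simplex n (s t : 'rV[R]_n.+1 -> T) :=
  forall v, std_simplex v -> s v = t v.

Definition coef n (c : chain n) (s : 'rV[R]_n.+1 -> T) : rat :=
  \sum_(a <- c | `[< same_simplex a.2 s >]) a.1.

Definition chain_eq n (c d : chain n) := forall s, coef c s = coef d s.

Definition chain_in (A : set T) n (c : chain n) :=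
  forall a, a \in c ->
    {within @std_simplex n, continuous a.2} /\
    (forall v, std_simplex v -> A (a.2 v)).

Definition scale_chain n (k : rat) (c : chain n) : chain n :=
  [seq (k * a.1, a.2) | a <- c].

Definition boundary n (c : chain n.+1) : chain n :=
  flatten [seq [seq ((-1) ^+ (i : nat) * a.1, a.2 \o @face_map n i)
                | i : 'I_n.+2 <- enum 'I_n.+2]
          | a : rat * ('rV[R]_n.+2 -> T) <- c].

Definition is_cycle n : chain n -> Prop :=
  match n with
  | 0 => fun=> True
  | n'.+1 => fun c => chain_eq (boundary c) [::]
  end.

(* k cycles of A whose classes in H_n(A; Q) are linearly independent *)
Definition independent_cycles (A : set T) n k (z : 'I_k -> chain n) :=
  (forall j, chain_in A (z j) /\ is_cycle (z j)) /\
  forall a : 'I_k -> rat,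
    (exists w : chain n.+1, chain_in A w /\
       chain_eq (boundary w)
         (flatten [seq scale_chain (a j) (z j) | j <- enum 'I_k])) ->
    forall j, a j = 0.

(* dim H_n(A; Q), when it is finite *)
Definition betti (A : set T) (n : nat) : R :=
  sup [set k%:R | k in
    [set k | exists z : 'I_k -> chain n, independent_cycles A z]].

(* A is meant to be an open subset of a surface, so that H_n(A) = 0 for n > 2. *)
Definition euler_char (A : set T) : R := betti A 0 - betti A 1 + betti A 2.

End Homology.

Definition X_sigma (R : realType) (Y : riemann_surface R) (sigma : Y -> R)
    (r : R) : R :=
  Rintegral (@lebesgue_measure R) `[1, r]
    (fun t => euler_char (sublevel sigma t) / t).

(* P^N is the set of lines of C^(N+1). *)
Definition projective_space (R : realType) (N : nat) :=
  {L : {vspace 'rV[CC R]_N.+1} | \dim L == 1%N}.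

Section Projective.
Context {R : realType} {N : nat}.
Local Notation PN := (projective_space R N).
Local Notation V := 'rV[CC R]_N.+1.

(* Nonzero, as L is a line: a system of homogeneous coordinates of L *)
Definition hcoord (L : PN) : V := vpick (val L).

Definition poly_at (p : mpoly N.+1 R[i]) (v : V) : R[i] :=
  meval (fun i => v ord0 i) p.

Definition homogeneous (d : nat) (p : mpoly N.+1 R[i]) :=
  p \is ishomog1 d mdeg.

Definition zariski_closed (Z : set PN) :=
  exists S : set (mpoly N.+1 R[i]),
    (forall p, S p -> exists d, homogeneous d p) /\
    Z = [set L | forall p, S p -> poly_at p (hcoord L) = 0].

Definition zariski_open (U : set PN) := zariski_closed (~` U).

Definition projective_variety (X : set PN) :=
  [/\ zariski_closed X, X !=set0 &
      forall Z1 Z2, zariski_closed Z1 -> zariski_closed Z2 ->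
        X `<=` Z1 `|` Z2 -> X `<=` Z1 \/ X `<=` Z2].

(* g is a regular function on the locally closed subset U of P^N *)
Definition regular_on (U : set PN) (g : PN -> R[i]) :=
  forall L, U L -> exists W, [/\ zariski_open W, W L &
    exists d p q, [/\ homogeneous d p, homogeneous d q &
      forall M, U M -> W M -> poly_at q (hcoord M) != 0 /\
        g M = poly_at p (hcoord M) / poly_at q (hcoord M)]].

(* An effective Cartier divisor on the variety X is given by local equations
   on an open cover of X.  As X is integral, a local equation is a nonzero
   divisor when it is not identically zero. *)
Record effective_cartier (X : set PN) := EffectiveCartier {
  ec_index : Type;
  ec_open : ec_index -> set PN;
  ec_eqn : ec_index -> PN -> R[i];
  ec_openP : forall i, exists W, zariski_open W /\ ec_open i = X `&` W;
  ec_cover : X `<=` \bigcup_i ec_open i;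
  ec_regular : forall i, regular_on (ec_open i) (ec_eqn i);
  ec_nonzero : forall i, exists L, ec_open i L /\ ec_eqn i L != 0;
  ec_compatible : forall i j, exists u : PN -> R[i],
    [/\ regular_on (ec_open i `&` ec_open j) u,
        forall L, ec_open i L -> ec_open j L -> u L != 0 &
        forall L, ec_open i L -> ec_open j L ->
          ec_eqn i L = u L * ec_eqn j L] }.

Arguments ec_open {X} D i : rename.
Arguments ec_eqn {X} D i : rename.

Definition div_support (X : set PN) (D : effective_cartier X) : set PN :=
  [set L | exists i, ec_open D i L /\ ec_eqn D i L = 0].

(* The affine open subset where the i-th homogeneous coordinate is nonzero, and
   the representative of L whose i-th coordinate is 1 *)
Definition affine_part (i : 'I_N.+1) : set PN :=
  [set L | hcoord L ord0 i != 0].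
Definition affine_coord (i : 'I_N.+1) (L : PN) : V :=
  (hcoord L ord0 i)^-1 *: hcoord L.

Definition holomorphic_map (Y : riemann_surface R) (f : Y -> PN) :=
  forall i, open (f @^-1` affine_part i) /\
    forall (p : Y) (j : 'I_N.+1),
      holomorphic_on (in_chart p (f @^-1` affine_part i))
        (fun z => affine_coord i (f (param p z)) ord0 j).

Definition cone (X : set PN) : set V :=
  [set v | v != 0 /\ exists2 L, X L & v \in val L].

Definition conj_tr m n (A : 'M[R[i]]_(m, n)) : 'M[R[i]]_(n, m) :=
  (map_mx (@conjc R) A)^T.

(* (1,1)-forms on P^N are described by their pull-back to C^(N+1) \ 0, namely
   (i/2) sum_jk H_jk dv_j /\ conj(dv_k), with H(v) Hermitian; a form
   upstairs comes from P^N when it is invariant under the homotheties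
   v |-> c v and vanishes along the radial direction.  The form is positive
   when it is positive definite modulo the radial direction.  As X may be
   singular, a form on X is a form defined at the points of X, which locally
   is the restriction of a smooth form of the ambient space. *)
Definition positive_form (X : set PN) (H : V -> 'M[R[i]]_N.+1) :=
  forall v, cone X v ->
  [/\ forall c : R[i], c != 0 -> H (c *: v) = (`|c| ^- 2) *: H v,
      conj_tr (H v) = H v,
      v *m H v = 0,
      forall a : V, a \notin <[v]>%VS ->
        0 < (a *m H v *m conj_tr a) ord0 ord0 &
      exists (W : set V) (G : V -> 'M[R[i]]_N.+1),
        [/\ open W, W v,
            forall j k, smooth_on W (fun w => complex.Re (G w j k)) /\
                        smooth_on W (fun w => complex.Im (G w j k)) &
            forall w, W w -> cone X w -> G w = H w]].

Section NevanlinnaFunctions.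
Context (Y : riemann_surface R) (sigma : Y -> R).

(* The function rho such that f^* eta = rho (i/2) dz /\ conj(dz) in the chart
   at p.  It is computed with the lift of f given by the affine coordinates, for
   the first i such that the i-th homogeneous coordinate of f does not vanish
   at the point considered; the result does not depend on i. *)
Definition pullback_density (H : V -> 'M[R[i]]_N.+1) (f : Y -> PN) (p : Y)
    (z : CC R) : R :=
  let i := odflt ord0 [pick i | hcoord (f (param p z)) ord0 i != 0] in
  let F := fun w : CC R => affine_coord i (f (param p w)) in
  let dF : V := \row_j derive1 (fun w : CC R => F w ord0 j : CC R) z in
  complex.Re ((dF *m H (F z) *m conj_tr dF) ord0 ord0).

Definition complex_of (w : R * R) : CC R := w.1 +i* w.2.

(* The integral over B of the nonnegative form f^* eta: supremum over the finite
   families of disjoint measurable subsets of B, each one contained in a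
   chart *)
Definition pullback_integral (H : V -> 'M[R[i]]_N.+1) (f : Y -> PN)
    (B : set Y) : \bar R :=
  ereal_sup [set s | exists n (p : 'I_n -> Y)
      (A : 'I_n -> set (measurableTypeR R * measurableTypeR R)),
    [/\ forall j, measurable (A j) /\ complex_of @` A j `<=` in_chart (p j) B,
        trivIset setT (fun j => param (p j) @` (complex_of @` A j)) &
        s = (\sum_(j < n)
              \int[@lebesgue_measure R \x @lebesgue_measure R]_(w in A j)
                (pullback_density H f (p j) (complex_of w))%:E)%E]].

(* Integrals from 1 to r are taken over [1, r], so they vanish for r < 1; these r
   form a set of finite measure, hence are irrelevant below. *)
Definition T_char (H : V -> 'M[R[i]]_N.+1) (f : Y -> PN) (r : R) : \bar R :=
  (\int[@lebesgue_measure R]_(t in `[1%R, r])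
     (pullback_integral H f (sublevel sigma t) * (t^-1)%:E))%E.

Definition N_trunc (f : Y -> PN) (S : set PN) (r : R) : \bar R :=
  (\int[@lebesgue_measure R]_(t in `[1%R, r])
     (counting (f @^-1` S `&` sublevel sigma t) * (t^-1)%:E))%E.

End NevanlinnaFunctions.
End Projective.

(* The choice of a vector field on each parabolic Riemann surface; vector
   fields are represented as in [holomorphic_field]. *)
Definition field_choice (R : realType) :=
  forall (Y : riemann_surface R) (sigma : Y -> R), Y -> CC R.

Definition nevanlinna_pair (R : realType) (N : nat) (xi : field_choice R)
    (X : set (projective_space R N)) (D : effective_cartier X) : Prop :=
  exists H : 'rV[CC R]_N.+1 -> 'M[R[i]]_N.+1, positive_form X H /\
  forall (Y : riemann_surface R) (sigma : Y -> R), parabolic_surface sigma ->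
  forall f : Y -> projective_space R N, holomorphic_map f -> (forall y, X (f y)) ->
  ~ (forall y, div_support D (f y)) ->
  forall delta : R, 0 < delta ->
  exists (C : R) (exc : set R),
    [/\ measurable exc, (@lebesgue_measure R exc < +oo)%E &
    forall r : R, 0 < r -> ~ exc r ->
      (T_char sigma H f r <=
         N_trunc sigma f (div_support D) r
         + (- X_sigma sigma r + (delta + 2 * varsigma sigma) * ln r)%:E
         + E_sigma sigma (xi Y sigma) r + C%:E)%E].

Section Plane.
Context (R : realType).

Definition plane_chart : chart R (CC R) := Chart setT id id.

Lemma plane_nonempty : [set: CC R] !=set0.
Proof. by exists 0. Qed.

Lemma plane_hausdorff : hausdorff_space (CC R).
Proof. exact: norm_hausdorff. Qed.

Lemma real_complex_continuous : continuous (fun t : R => t%:C : CC R).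
Proof.
move=> t; apply/cvgrPdist_lt => -[e e'] /=; rewrite ltcE /= => /andP[/eqP -> e0].
have : \forall s \near t, `|t - s| < e by move/cvgrPdist_lt: (@cvg_id _ (nbhs t)); exact.
apply: filterS => s ts.
by rewrite -rmorphB normc_def /= expr0n addr0 sqrtr_sqr ltcR.
Qed.

Lemma plane_connected : connected [set: CC R].
Proof.
have -> : [set: CC R] = \bigcup_(z in [set: CC R]) [set t%:C * z | t in [set: R]].
  by apply/seteqP; split=> z // _; exists z => //; exists 1 => //; rewrite mul1r.
apply: bigcup_connected => [|z _].
  by exists 0 => z _; exists 0 => //; rewrite mul0r.
apply: connected_continuous_connected; first by apply/connected_intervalP.
apply: continuous_subspaceT => t.
by apply: (@cvgMr_tmp R[i]); exact: real_complex_continuous.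
Qed.

Lemma plane_chartP (p : CC R) : is_chart plane_chart.
Proof.
split=> //=; [exact: openT|by rewrite image_id; exact: openT|].
by split; apply: continuous_subspaceT => x; exact: cvg_id.
Qed.

Lemma plane_transition (p q : CC R) :
  holomorphic_on (cmap plane_chart @` (cdom plane_chart `&` cdom plane_chart))
    (cmap plane_chart \o cinv plane_chart).
Proof. by move=> z _; exact: derivable_id. Qed.

Definition complex_plane : riemann_surface R :=
  @RiemannSurface R (CC R) (fun=> plane_chart)
    plane_nonempty plane_hausdorff plane_connected plane_chartP (fun=> I)
    plane_transition.

End Plane.

(* xi chooses a nowhere vanishing holomorphic vector field on each parabolic
   Riemann surface, and d/dz on C with sigma = |z|. *)
Definition admissible_choice (R : realType) (xi : field_choice R) :=
  (forall (Y : riemann_surface R) (sigma : Y -> R), parabolic_surface sigma ->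
     holomorphic_field (xi Y sigma) /\ forall y, xi Y sigma y != 0) /\
  xi (complex_plane R) (@modulus R) = (fun=> 1).

Definition brody_hyperbolic (R : realType) (N : nat) (U : set (projective_space R N)) :=
  forall f : complex_plane R -> projective_space R N,
    holomorphic_map f -> (forall z, U (f z)) -> forall z w, f z = f w.

(* Main.v *)
(* Test the Nevanlinna inequality on the plane, with sigma(z) = |z|, for a
   nonconstant f : C -> X \ D.  There N_f(r, D) = 0, varsigma <= 1/2, the discs
   have Euler characteristic 1, so that X_sigma(r) = ln r, and
   |d sigma (d/dz)| = 1/2 makes E_sigma bounded.  The inequality becomes
   T_f(r) <= delta ln r + O(1) outside a set of finite measure, while T_f(r)
   is at least c ln r - O(1) with c > 0 the mass of f^* eta on some small
   square: delta = c / 2 is contradictory.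

   The upper bound of varsigma holds because disjoint arcs drawn on a circle lift
   to intervals of the line whose translates by 2 pi Z are disjoint.

   The positivity of c does not use Cauchy's theory.  If the density of
   f^* eta vanishes almost everywhere on a square, so does the derivative of a
   local lift of f; by Fubini the lift is constant on almost every vertical
   segment, since an everywhere differentiable function of a real variable whose
   derivative vanishes almost everywhere is constant; by continuity it is
   constant on every vertical segment, so its derivative is zero. *)

Require Import Defs.
From HB Require Import structures.
From mathcomp Require Import all_boot all_order all_algebra.
From mathcomp Require Import all_classical all_reals all_analysis.
From mathcomp Require Import measurable_realfun complex ring lra.
Import numFieldNormedType.Exports.
Import Order.TTheory GRing.Theory Num.Theory.

Set Implicit Arguments.
Unset Strict Implicit.
Unset Printing Implicit Defensive.

Local Open Scope classical_set_scope.
Local Open Scope complex_scope.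
Local Open Scope ring_scope.

(** * The complex plane *)

Section ComplexTopology.
Context {R : realType}.
Implicit Types z w : CC R.
Local Notation Re := (@complex.Re R).
Local Notation Im := (@complex.Im R).

(** All estimates but one are one-sided, which matches the encoding by suprema. [varsigma] and
    [E_sigma] stand on the large side of the inequality and come from suprema over families of arcs:
    bounding every family from above is enough, and no arc on a circle is ever exhibited. [T_char]
    stands on the small side and comes from a supremum over families of plane sets: a single square
    is enough. The exception is [X_sigma], which must be computed, because its term - ln r is what
    absorbs 2 [varsigma] ln r; hence the rational homology of discs, obtained from the cone operator
    with vertex 0.

    The obstacle in the lower bound is that [pullback_density] changes affine chart from point to
    point. The square is therefore taken where the set of nonvanishing homogeneous coordinates is
    locally constant. That f has a nonzero derivative at some such point is a connectedness
    statement, in which no identity theorem for holomorphic functions intervenes. *)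

Lemma modulusE z : modulus z = Num.sqrt (Re z ^+ 2 + Im z ^+ 2).
Proof. by case: z. Qed.

Lemma norm_modulus z : `|z| = (modulus z)%:C.
Proof. by case: z => a b; rewrite normc_def. Qed.

Lemma modulus_ge0 z : 0 <= modulus z.
Proof. by rewrite modulusE sqrtr_ge0. Qed.

Lemma modulus_sqr z : modulus z ^+ 2 = Re z ^+ 2 + Im z ^+ 2.
Proof. by rewrite modulusE sqr_sqrtr// addr_ge0// sqr_ge0. Qed.

Lemma modulus_gt0 z : (0 < modulus z) = (z != 0).
Proof. by rewrite -(ltcR 0) -norm_modulus normr_gt0. Qed.

Lemma modulusN z : modulus (- z) = modulus z.
Proof. by rewrite !modulusE !raddfN !sqrrN. Qed.

Lemma modulusM z w : modulus (z * w) = modulus z * modulus w.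
Proof. exact: ComplexField.Normc.normcM. Qed.

Lemma modulusD z w : modulus (z + w) <= modulus z + modulus w.
Proof. by rewrite -lecR rmorphD/= -!norm_modulus; exact: ler_normD. Qed.

Lemma Re_le_modulus z : `|Re z| <= modulus z.
Proof. by rewrite modulusE -sqrtr_sqr ler_wsqrtr// lerDl sqr_ge0. Qed.

Lemma Im_le_modulus z : `|Im z| <= modulus z.
Proof. by rewrite modulusE -sqrtr_sqr ler_wsqrtr// lerDr sqr_ge0. Qed.

Lemma modulus_le z : modulus z <= `|Re z| + `|Im z|.
Proof.
rewrite -(ler_pXn2r (n := 2)) ?nnegrE ?modulus_ge0 ?addr_ge0//.
rewrite modulus_sqr sqrrD !real_normK ?num_real//.
by rewrite addrAC lerDl mulrn_wge0// mulr_ge0.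
Qed.

(** The norm of [CC R] takes its values in [R[i]], so the radii in its convergence criterion are
    complex; a positive one has zero imaginary part, which reduces the criterion to real radii. *)
Lemma cvg_modulus (T : Type) (F : set_system T) {FF : Filter F} (f : T -> CC R) w :
  modulus (w - f x) @[x --> F] --> (0 : R) -> f x @[x --> F] --> w.
Proof.
move=> h; apply/cvgrPdist_lt => -[e e'] /=; rewrite ltcE /= => /andP[/eqP -> e0].
move/cvgrPdist_lt: h => /(_ e e0); apply: filterS => x.
by rewrite sub0r normrN ger0_norm ?modulus_ge0// norm_modulus ltcR.
Qed.

Lemma near_modulus z e : 0 < e -> \forall w \near z, modulus (z - w) < e.
Proof.
move=> e0; have e0' : 0 < e%:C by rewrite ltcR.
apply: filterS (@nbhsx_ballx _ (CC R) z _ e0') => w.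
by rewrite -ball_normE /ball_/= norm_modulus ltcR.
Qed.

Lemma nbhs_modulus z (A : set (CC R)) :
  nbhs z A -> exists2 e, 0 < e & forall w, modulus (z - w) < e -> A w.
Proof.
move=> /nbhs_ballP[[e e'] /=]; rewrite ltcE /= => /andP[/eqP -> e0] zA.
by exists e => // w zw; apply: zA; rewrite -ball_normE /ball_/= norm_modulus ltcR.
Qed.

Lemma continuous_Re : continuous (Re : CC R -> R).
Proof.
move=> z; apply/(@cvgrPdist_lt _ _ _ (nbhs z) (nbhs_filter z)) => e e0.
apply: filterS (near_modulus z e0) => w; apply: le_lt_trans.
by rewrite -raddfB Re_le_modulus.
Qed.

Lemma continuous_Im : continuous (Im : CC R -> R).
Proof.
move=> z; apply/(@cvgrPdist_lt _ _ _ (nbhs z) (nbhs_filter z)) => e e0.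
apply: filterS (near_modulus z e0) => w; apply: le_lt_trans.
by rewrite -raddfB Im_le_modulus.
Qed.

Lemma continuous_modulus : continuous (@modulus R).
Proof.
have -> : @modulus R = fun w : CC R => Num.sqrt (Re w ^+ 2 + Im w ^+ 2).
  by apply/funext => w; rewrite modulusE.
move=> z; apply: (@continuous_comp _ _ _ (fun w : CC R => Re w ^+ 2 + Im w ^+ 2) (@Num.sqrt R)).
  apply: (@cvgD _ R (CC R) (nbhs z)).
    by apply: (@cvgM _ _ (nbhs z)); exact: continuous_Re.
  by apply: (@cvgM _ _ (nbhs z)); exact: continuous_Im.
exact: sqrt_continuous.
Qed.

Lemma cvg_complex (T : Type) (F : set_system T) {FF : Filter F} (f g : T -> R) a b :
  f x @[x --> F] --> a -> g x @[x --> F] --> b ->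
  ((f x +i* g x : CC R) @[x --> F] --> (a +i* b : CC R)).
Proof.
move=> fa gb; apply: cvg_modulus.
apply: (@squeeze_cvgr _ _ _ _ (fun=> 0) (fun x => `|a - f x| + `|b - g x|)).
- by apply: nearW => x; rewrite modulus_ge0 modulus_le.
- exact: cvg_cst.
- rewrite -[X in _ --> X](addr0 0); apply: cvgD; apply/norm_cvg0P.
    by rewrite -[X in _ --> X](subrr a); apply: cvgB => //; exact: cvg_cst.
  by rewrite -[X in _ --> X](subrr b); apply: cvgB => //; exact: cvg_cst.
Qed.

Lemma continuous_complex_of : continuous (fun w : R * R => complex_of w : CC R).
Proof. by move=> [a b]; apply: cvg_complex; [exact: cvg_fst|exact: cvg_snd]. Qed.

Lemma open_neq_plane (c : CC R) : open [set z | z != c].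
Proof.
have -> : [set z | z != c] = ~` [set c].
  by apply/seteqP; split=> z /=; [move=> /eqP|move=> h; apply/eqP].
rewrite openC; apply: accessible_closed_set1.
by apply: hausdorff_accessible; exact: plane_hausdorff.
Qed.

(** The closed disc of radius M lies in the image of the real square of half-side M, which is
    compact as a product of segments. *)
Lemma compact_modulus (K : set (CC R)) (M : R) :
  closed K -> (forall z, K z -> modulus z <= M) -> compact K.
Proof.
move=> cK KM.
have cS : compact ((fun w : R * R => complex_of w : CC R) @` (`[-M, M] `*` `[-M, M])).
  apply: continuous_compact.
    by apply: continuous_subspaceT; exact: continuous_complex_of.
  by apply: compact_setX; exact: segment_compact.
apply: (subclosed_compact cK cS) => -[a b] /KM Mz.
exists (a, b) => //=; split; rewrite /= in_itv/= -ler_norml (le_trans _ Mz)//.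
  exact: (Re_le_modulus (a +i* b)).
exact: (Im_le_modulus (a +i* b)).
Qed.

Lemma modulus_real (x : R) : modulus (x%:C : CC R) = `|x|.
Proof. by rewrite modulusE/= expr0n addr0 sqrtr_sqr. Qed.

Lemma noncompact_plane : ~ compact [set: CC R].
Proof.
move=> cC.
have : compact (@modulus R @` setT).
  by apply: continuous_compact => //; apply: continuous_subspaceT; exact: continuous_modulus.
move=> /compact_bounded[M [Mr]] /(_ (`|M| + 1)).
move=> /(_ (ltr_pwDr ltr01 (ler_norm _))) /(_ (`|M| + 2)) /=.
have := normr_ge0 M => M0 h.
have : `|(`|M| + 2 : R)| <= `|M| + 1.
  by apply: h; exists ((`|M| + 2)%:C) => //; rewrite modulus_real ger0_norm//; lra.
by rewrite ger0_norm; lra.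
Qed.

Lemma proper_modulus (K : set R) : compact K -> compact (@modulus R @^-1` K).
Proof.
move=> cK; have [M [Mr KM]] := compact_bounded cK.
apply: (@compact_modulus _ (`|M| + 1)).
  apply: closed_comp => [z _|]; first exact: continuous_modulus.
  exact: compact_closed.
move=> z Kz; rewrite -[leLHS]ger0_norm ?modulus_ge0//.
apply: (KM (`|M| + 1)) => //; exact: (ltr_pwDr ltr01 (ler_norm _)).
Qed.

End ComplexTopology.

(** * The logarithm of the modulus is harmonic *)

Section ClassC.
Context {R : realType} {V : normedModType R[i]}.

Lemma near_line (W : set V) (v a : V) : open W -> W v ->
  \forall t \near (0 : R), W (v + t%:C *: a).
Proof.
move=> oW Wv.
have h : (v + t%:C *: a) @[t --> (0 : R)] --> v.
  rewrite -[X in _ --> X]addr0 -(scale0r a).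
  apply: (@cvgD _ V R (nbhs (0 : R))); first exact: cvg_cst.
  apply: (@cvgZr_tmp _ V R (nbhs (0 : R)) _ (fun t : R => t%:C : R[i]^o)).
  exact: (@real_complex_continuous R 0).
by apply: h; exact: open_nbhs_nbhs.
Qed.

Lemma rderiv_eq (W : set V) (u u' : V -> R) (a v : V) : open W ->
  (forall w, W w -> u w = u' w) -> W v -> rderiv a u v = rderiv a u' v.
Proof.
move=> oW uu' Wv; rewrite /rderiv !derive1E; apply: near_eq_derive.
by apply: filterS (near_line a oW Wv) => t; exact: uu'.
Qed.

Lemma continuous_at_eq (T : topologicalType) (W : set V) (u u' : V -> T) (v : V) :
  open W -> (forall w, W w -> u w = u' w) -> W v ->
  {for v, continuous u} -> {for v, continuous u'}.
Proof.
move=> oW uu' Wv cu.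
have h : \forall w \near v, u w = u' w.
  by apply: filterS (open_nbhs_nbhs (conj oW Wv)) => w; exact: uu'.
suff : u' @ v --> u' v by [].
by rewrite -(uu' _ Wv); apply: cvg_trans cu; exact: near_eq_cvg.
Qed.

(** On an open set the directional derivatives depend only on the values there, so the induction
    passes to them. This allows the derivatives of log |z| to be replaced by closed formulas away
    from 0. *)
Lemma class_C_eq k (W : set V) (u u' : V -> R) : open W ->
  (forall v, W v -> u v = u' v) -> class_C k W u -> class_C k W u'.
Proof.
move=> oW; elim: k u u' => [|k IH] u u' uu' /=.
  move=> [cu _]; split=> // v Wv.
  exact: (continuous_at_eq oW uu' Wv (cu v Wv)).
move=> [cu du]; split.
  move=> v Wv.
  exact: (continuous_at_eq oW uu' Wv (cu v Wv)).
move=> a; have [d1 d2] := du a; split=> [v Wv|].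
  apply: near_eq_derivable (d1 v Wv).
  by apply: filterS (near_line a oW Wv) => t; exact: uu'.
by apply: (IH (rderiv a u)) => // v Wv; exact: rderiv_eq oW uu' Wv.
Qed.
End ClassC.

Section LogModulus.
Context {R : realType}.
Implicit Types z a b : CC R.
Local Notation Re := (@complex.Re R).
Local Notation Im := (@complex.Im R).

Let sq z : R := Re z ^+ 2 + Im z ^+ 2.
Let dot a b : R := Re a * Re b + Im a * Im b.

Lemma sq_gt0 z : z != 0 -> 0 < sq z.
Proof. by rewrite -modulus_gt0 /sq -modulus_sqr => z0; rewrite exprn_gt0. Qed.

Lemma ln_modulus z : z != 0 -> ln (modulus z) = 2^-1 * ln (sq z).
Proof.
move=> z0; rewrite /sq -modulus_sqr lnXn ?modulus_gt0// -(mulr_natl (ln _)) mulrA mulVf ?mul1r//.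
Qed.

Lemma is_derive_line_re z a : is_derive (0 : R) 1 (fun t => Re (z + t%:C *: a)) (Re a).
Proof.
have -> : (fun t => Re (z + t%:C *: a)) = (fun t => Re z + t * Re a).
  by apply/funext => t; case: z a => [x y] [c d] /=; rewrite mul0r subr0.
by apply: is_derive_eq; rewrite !scale0r /GRing.scale/=; ring.
Qed.

Lemma is_derive_line_im z a : is_derive (0 : R) 1 (fun t => Im (z + t%:C *: a)) (Im a).
Proof.
have -> : (fun t => Im (z + t%:C *: a)) = (fun t => Im z + t * Im a).
  by apply/funext => t; case: z a => [x y] [c d] /=; rewrite mul0r addr0.
by apply: is_derive_eq; rewrite !scale0r /GRing.scale/=; ring.
Qed.

Lemma is_derive_line_sq z a : is_derive (0 : R) 1 (fun t => sq (z + t%:C *: a)) (2 * dot a z).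
Proof.
have h1 := is_derive_line_re z a; have h2 := is_derive_line_im z a.
apply: is_derive_eq.
rewrite /dot /= !scale0r !addr0 /GRing.scale/=; ring.
Qed.

Lemma is_derive_line_dot z a b : is_derive (0 : R) 1 (fun t => dot b (z + t%:C *: a)) (dot b a).
Proof.
have h1 := is_derive_line_re z a; have h2 := is_derive_line_im z a.
apply: is_derive_eq.
rewrite /dot /= /GRing.scale/=; ring.
Qed.

(** The derivative of log |z| in the direction a, that is, the real part of a / z. *)
Let log2 a z : R := dot a z / sq z.

(** The derivative of [log2 a] in the direction b, by the quotient rule. *)
Let log3 a b z : R := (dot a b * sq z - 2 * dot a z * dot b z) / (sq z ^+ 2).

Lemma is_derive_ln_modulus z a : z != 0 ->
  is_derive (0 : R) 1 (fun t => ln (modulus (z + t%:C *: a))) (log2 a z).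
Proof.
move=> z0.
have near_ln : \forall t \near (0 : R), 2^-1 * (@ln R \o (fun t => sq (z + t%:C *: a))) t =
    ln (modulus (z + t%:C *: a)).
  by have := near_line a (@open_neq_plane R 0) z0; apply: filterS => t /ln_modulus ->.
apply: (near_eq_is_derive near_ln).
have h := is_derive_line_sq z a.
have h' : is_derive (sq (z + (0 : R)%:C *: a)) 1 (@ln R) (sq z)^-1.
  by rewrite scale0r addr0; apply: is_derive1_ln; exact: sq_gt0.
have h2 := @is_derive1_comp R _ _ 0 _ _ h' h.
by apply: is_derive_eq; rewrite /log2 /GRing.scale/=; field; rewrite gt_eqF// sq_gt0.
Qed.

Lemma is_derive_log2 z a b : z != 0 ->
  is_derive (0 : R) 1 (fun t => log2 a (z + t%:C *: b)) (log3 a b z).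
Proof.
move=> z0; have s0 : sq z != 0 by rewrite gt_eqF// sq_gt0.
have h1 := is_derive_line_sq z b; have h2 := is_derive_line_dot z b a.
have e0 : z + (0 : R)%:C *: b = z by rewrite scale0r addr0.
have h3 : is_derive (0 : R) 1 (fun t => (sq (z + t%:C *: b))^-1) (- (sq z) ^- 2 *: (2 * dot b z)).
  by rewrite -{2}e0; apply: is_deriveV => //; rewrite e0.
apply: is_derive_eq; rewrite !e0 /log3 /GRing.scale/=; field; exact: s0.
Qed.

Lemma continuous_dot a z : {for z, continuous (dot a)}.
Proof.
apply: (@cvgD _ R (CC R) (nbhs z)).
  by apply: (@cvgM _ _ (nbhs z)); [exact: cvg_cst|exact: continuous_Re].
by apply: (@cvgM _ _ (nbhs z)); [exact: cvg_cst|exact: continuous_Im].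
Qed.

Lemma continuous_sq z : {for z, continuous sq}.
Proof.
apply: (@cvgD _ R (CC R) (nbhs z)).
  by apply: (@cvgM _ _ (nbhs z)); exact: continuous_Re.
by apply: (@cvgM _ _ (nbhs z)); exact: continuous_Im.
Qed.

Lemma continuous_log2 a z : z != 0 -> {for z, continuous (log2 a)}.
Proof.
move=> z0; apply: (@cvgM _ _ (nbhs z)); first exact: continuous_dot.
by apply: cvgV; [rewrite gt_eqF// sq_gt0|exact: continuous_sq].
Qed.

Lemma continuous_log3 a b z : z != 0 -> {for z, continuous (log3 a b)}.
Proof.
move=> z0; apply: (@cvgM _ _ (nbhs z)); last first.
  apply: cvgV; first by rewrite expf_neq0// gt_eqF// sq_gt0.
  by apply: (@cvgM _ _ (nbhs z)); exact: continuous_sq.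
apply: (@cvgB _ R (CC R) (nbhs z)).
  by apply: (@cvgM _ _ (nbhs z)); [exact: cvg_cst|exact: continuous_sq].
apply: (@cvgM _ _ (nbhs z)); last exact: continuous_dot.
by apply: (@cvgM _ _ (nbhs z)); [exact: cvg_cst|exact: continuous_dot].
Qed.

Lemma rderiv_ln_modulus a z : z != 0 ->
  rderiv a (fun z : CC R => ln (modulus z)) z = log2 a z.
Proof.
by move=> z0; rewrite /rderiv derive1E; have [_ ->] := is_derive_ln_modulus a z0.
Qed.

Lemma rderiv_log2 a b z : z != 0 -> rderiv b (log2 a) z = log3 a b z.
Proof.
by move=> z0; rewrite /rderiv derive1E; have [_ ->] := is_derive_log2 a b z0.
Qed.

Let W : set (CC R) := [set z | z != 0].

(** When a runs over the directions 1 and i, the terms [dot a a * sq z] add up to 2 |z|^2, and so do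
    the terms [2 * dot a z * dot a z]; the numerators of the second derivatives cancel. *)
Lemma harmonic_ln_modulus : harmonic_on W (fun z : CC R => ln (modulus z)).
Proof.
have oW : open W := (@open_neq_plane R 0).
split.
  split.
    move=> z z0; apply: (@continuous_comp _ _ _ (@modulus R) (@ln R)).
      exact: continuous_modulus.
    by apply: continuous_ln; rewrite modulus_gt0.
  move=> a; split=> [z z0|]; first by have [] := is_derive_ln_modulus a z0.
  apply: (class_C_eq oW (u := log2 a)) => [z z0|].
    by rewrite rderiv_ln_modulus.
  split; first by move=> z; exact: continuous_log2.
  move=> b; split=> [z z0|]; first by have [] := is_derive_log2 a b z0.
  apply: (class_C_eq oW (u := log3 a b)) => [z z0|].
    by rewrite rderiv_log2.
  by split=> // z; exact: continuous_log3.
move=> z z0; rewrite /d_dx /d_dy.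
have e a : rderiv a (rderiv a (fun z : CC R => ln (modulus z))) z = log3 a a z.
  rewrite (rderiv_eq (u' := log2 a) _ oW)//; first exact: rderiv_log2.
  by move=> w; exact: rderiv_ln_modulus.
rewrite !e /log3 -mulrDl /dot /sq /=.
by rewrite [X in X / _](_ : _ = 0) ?mul0r//; ring.
Qed.

Lemma class_C_cst k (V : normedModType R[i]) (U : set V) (c : R) : class_C k U (fun=> c).
Proof.
elim: k c => [|k IH] c /=; first by split=> // v _; exact: cvg_cst.
split=> [v _|a]; first exact: cvg_cst.
split=> [v _|]; first exact: derivable_cst.
rewrite (_ : rderiv a _ = fun=> 0); first exact: IH.
by apply/funext => v; rewrite /rderiv derive1_cst.
Qed.

Lemma parabolic_plane : parabolic_surface (Y := complex_plane R) (@modulus R).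
Proof.
split; first exact: noncompact_plane.
split.
- exact: continuous_modulus.
- exact: modulus_ge0.
- exact: proper_modulus.
exists [set (0 : CC R)]; split; first exact: finite_set1.
- by move=> y /eqP y0; rewrite modulus_gt0.
- move=> q; rewrite (_ : in_chart q _ = W); first exact: harmonic_ln_modulus.
  apply/seteqP; split=> z /=; first by move=> [y [_ /eqP y0] <-].
  by move=> /eqP z0; exists z.
move=> p ->; exists setT; split; [exact: openT|by []|by rewrite setTI|].
(* At the origin log |z| already has the required form, with k = 1 and h = 0. *)
exists 1, (fun=> 0); split.
  split; first exact: class_C_cst.
  move=> z _; rewrite /d_dx /d_dy /rderiv.
  by rewrite !derive1_cst !addr0 // derive1_cst.
by move=> y _ _; rewrite /coord /= subr0 mul1r addr0.
Qed.

End LogModulus.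

(** * Arcs on a circle *)

Section CircleArcs.
Context {R : realType}.
Local Notation mu := (@lebesgue_measure R).

Lemma fsum_finType (I : finType) (f : I -> \bar R) :
  (\sum_(i \in [set: I]) f i = \sum_i f i)%E.
Proof.
have -> : [set: I] = [set` enum I].
  by apply/seteqP; split=> i //= _; rewrite mem_enum.
by rewrite -fsbig_seq ?enum_uniq// big_enum.
Qed.

(* The intervals ]a j, b j[ embed disjointly in the circle, so their first n
   translates by multiples of 2 pi are disjoint and fit in an interval of
   length 2 pi n + O(1). *)
Lemma circle_packing J (a b : 'I_J -> R) :
  (forall j, a j <= b j) ->
  (forall j k u v, a j < u < b j -> a k < v < b k ->
     cos u = cos v -> sin u = sin v -> j = k /\ u = v) ->
  \sum_j (b j - a j) <= 2 * pi.
Proof.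
move=> ab disj.
have pi0 := pi_gt0 R.
pose K : R := \sum_j (`|a j| + `|b j|).
have K0 : 0 <= K by apply: sumr_ge0 => j _; exact: addr_ge0.
have abK j : - K <= a j /\ b j <= K.
  have : `|a j| + `|b j| <= K.
    rewrite /K (bigD1 j)//= lerDl; apply: sumr_ge0 => k _; exact: addr_ge0.
  have := ler_norm (b j); have := lerNnormlW (lexx `|a j|).
  have := normr_ge0 (a j); have := normr_ge0 (b j); lra.
pose S : R := \sum_j (b j - a j).
have key n : n%:R * S <= n%:R * (2 * pi) + (2 * K + 1).
  pose F (i : 'I_J * 'I_n) : set R :=
    [set` `]a i.1 + 2 * pi * (i.2 : nat)%:R, b i.1 + 2 * pi * (i.2 : nat)%:R[].
  have mF i : measurable (F i) by exact: measurable_itv.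
  have muF i : mu (F i) = (b i.1 - a i.1)%:E.
    rewrite lebesgue_measure_itv /= lte_fin ltrD2r.
    case: ltP => [_|ba]; first by rewrite -EFinB; congr EFin; ring.
    congr EFin; have := ab i.1; lra.
  have per (x : R) m : cos (x - (2 * pi) * m%:R) = cos x /\ sin (x - (2 * pi) * m%:R) = sin x.
    have -> : 2 * pi * m%:R = (pi *+ 2) *+ m :> R.
      by rewrite mulr_natr mulr_natl.
    split; rewrite -[in RHS](subrK (pi *+ 2 *+ m) x).
      by rewrite (periodicn (@cosD2pi R)).
    by rewrite (periodicn (@sinD2pi R)).
  have tF : trivIset setT F.
    apply/trivIsetP => -[j m] [k p] _ _ /eqP jk; apply/seteqP; split=> // x.
    rewrite /F /= !in_itv/= => -[/andP[h1 h2] /andP[h3 h4]].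
    apply: jk.
    have [||||jk uv] := disj j k (x - (2 * pi) * m%:R) (x - (2 * pi) * p%:R).
    - lra.
    - lra.
    - by rewrite (per x m).1 (per x p).1.
    - by rewrite (per x m).2 (per x p).2.
    congr pair => //; apply/val_inj/eqP; rewrite -(eqr_nat R); apply/eqP.
    by move: uv => /addrI/oppr_inj; apply: mulfI; rewrite gt_eqF// mulr_gt0.
  (* The extra 1 keeps the interval nonempty even when [K] and n are zero. *)
  have : (mu (\bigcup_(i in setT) F i) <= mu [set` `](- K)%R, (K + 1 + 2 * pi * n%:R)%R[])%E.
    apply: le_measure; rewrite ?inE//.
      apply: fin_bigcup_measurable; first exact: finite_finset.
      by move=> i _; exact: mF. 
    move=> x [[j m] _]; rewrite /F/= !in_itv/= => /andP[h1 h2].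
    have [h3 h4] := abK j.
    have : 0 <= 2 * pi * (m : nat)%:R :> R by rewrite mulr_ge0// mulr_ge0// ltW.
    have : 2 * pi * (m : nat)%:R <= 2 * pi * n%:R :> R.
      by rewrite ler_wpM2l ?mulr_ge0// ?ltW// ltr_nat.
    lra.
  rewrite measure_fin_bigcup; [|exact: finite_finset|exact: tF|by move=> i _; exact: mF].
  rewrite fsum_finType (eq_bigr (fun i => (b i.1 - a i.1)%:E)); last by move=> i _; exact: muF.
  rewrite sumEFin lebesgue_measure_itv /= lte_fin ifT; last first.
    have : 0 <= 2 * pi * n%:R :> R by rewrite mulr_ge0// mulr_ge0// ltW.
    lra.
  rewrite -EFinB lee_fin -(pair_big xpredT xpredT (fun j (_ : 'I_n) => b j - a j))/=.
  rewrite (eq_bigr (fun j => n%:R * (b j - a j))); last first.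
    by move=> j _; rewrite sumr_const card_ord mulr_natl.
  rewrite -mulr_sumr -/S; lra.
(* Otherwise n (S - 2 pi) would be at most 2 K + 1 for every n, against the archimedean property. *)
rewrite leNgt; apply/negP => h.
have e0 : 0 < S - 2 * pi by rewrite subr_gt0.
have K1 : 0 < 2 * K + 1 by lra.
have := archi_boundP (ltW (divr_gt0 K1 e0)); rewrite ltr_pdivrMr//.
have := key (Num.bound ((2 * K + 1) / (S - 2 * pi))); rewrite mulrBr; lra.
Qed.

End CircleArcs.

(** * Lifting an arc of a circle to its angle *)

Section ArcLift.
Context {R : realType}.
Local Notation mu := (@lebesgue_measure R).

Lemma derive0_cst_oo (a b : R) (f : R -> R) :
  (forall t, a < t < b -> is_derive t 1 f 0) ->
  forall s t, a < s < b -> a < t < b -> f s = f t.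
Proof.
move=> df.
have le s t : a < s < b -> a < t < b -> s <= t -> f s = f t.
  move=> /andP[h1 h2] /andP[h3 h4] st.
  have dst u : u \in `[s, t]%R -> is_derive u 1 f 0.
    by rewrite in_itv/= => /andP[su ut]; apply: df; apply/andP; lra.
  have cf : {within `[s, t], continuous f}.
    by apply: derivable_within_continuous => u /dst [].
  have df' u : u \in `]s, t[%R -> is_derive u 1 f ((cst 0 : R -> R) u).
    by move=> /subset_itv_oo_cc; exact: dst.
  have [c _ h] := MVT_segment st df' cf.
  by apply/esym/eqP; rewrite -subr_eq0 h mul0r.
move=> s t hs ht; have [st|ts] := leP s t; first exact: le.
by apply/esym/le => //; exact: ltW.
Qed.

Lemma is_derive_derive1 (f : R -> R) (t d : R) :
  derivable f t 1 -> derive1 f t = d -> is_derive t 1 f d.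
Proof. by move=> h e; apply: DeriveDef; [exact: h|rewrite -derive1E]. Qed.

Lemma exists_angle (p q : R) : p ^+ 2 + q ^+ 2 = 1 -> exists u, p = cos u /\ q = sin u.
Proof.
move=> pq.
have p1 : -1 <= p <= 1.
  by rewrite -ler_norml -(ler_pXn2r (n := 2)) ?nnegrE// real_normK ?num_real// expr1n -pq
    lerDl sqr_ge0.
have s : sin (acos p) = `|q|.
  rewrite sin_acos//; have -> : 1 - p ^+ 2 = q ^+ 2 by rewrite -pq; ring.
  by rewrite sqrtr_sqr.
have [q0|q0] := leP 0 q.
  by exists (acos p); rewrite acosK// s ger0_norm.
by exists (- acos p); rewrite cosN sinN acosK// s ltr0_norm// opprK.
Qed.

(** Integrating the angular velocity [om] gives a continuous angle [th] along the arc. An injective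
    arc has an injective angle, hence a monotone one, so that the integral of |om| is the distance
    between the extreme angles. These are a and b, and every angle strictly between them is
    attained. *)
Lemma arc_lift (r : R) (x y : R -> R) : 0 < r ->
  (forall t : R, 0 <= t <= 1 -> derivable x t 1 /\ derivable y t 1) ->
  {within `[0, 1], continuous (derive1 x)} ->
  {within `[0, 1], continuous (derive1 y)} ->
  (forall s t : R, 0 < s < 1 -> 0 < t < 1 -> (x s, y s) = (x t, y t) -> s = t) ->
  (forall t : R, 0 < t < 1 -> x t ^+ 2 + y t ^+ 2 = r ^+ 2) ->
  exists a b : R, [/\ a <= b,
    measurable_fun (`]0, 1[%classic : set R)
      (fun t => `| (x t * derive1 y t - y t * derive1 x t) / r ^+ 2 | : R),
    (\int[mu]_(t in `]0%R, 1%R[)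
       (`| (x t * derive1 y t - y t * derive1 x t) / r ^+ 2 |)%:E = (b - a)%:E)%E,
    (forall u, a < u < b ->
       exists2 t, 0 < t < 1 & x t = r * cos u /\ y t = r * sin u) &
    (forall u v, a < u < b -> a < v < b -> cos u = cos v -> sin u = sin v -> u = v)].
Proof.
move=> r0 dxy cx' cy' inj circ.
have r20 : r ^+ 2 != 0 by rewrite expf_neq0// gt_eqF.
pose om t := (x t * derive1 y t - y t * derive1 x t) / r ^+ 2.
have cx : {within `[0, 1], continuous x}.
  by apply: derivable_within_continuous => t; rewrite in_itv/= => /dxy[h _]; exact: h.
have cy : {within `[0, 1], continuous y}.
  by apply: derivable_within_continuous => t; rewrite in_itv/= => /dxy[_ h]; exact: h.
have com : {within `[0, 1], continuous om}.
  move=> t; apply: cvgM; last exact: cvg_cst.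
  by apply: cvgB; apply: cvgM; [exact: cx|exact: cy'|exact: cy|exact: cx'].
have iom : mu.-integrable `[0, 1] (EFin \o om).
  by apply: continuous_compact_integrable => //; exact: segment_compact.
pose I t : R := \int[mu]_(u in `[0, t]) om u.
have dI (t : R) : 0 < t < 1 -> is_derive t 1 I (om t).
  move=> /andP[t0 t1].
  have [|d1 d2] := continuous_FTC1_closed t1 iom t0.
    by apply: (within_continuous_continuous _ com); rewrite ?in_itv/= ?t0.
  exact: is_derive_derive1 d1 d2.
(* The angle is normalized at the midpoint because the equation of the circle is given on the open
   interval only. *)
pose hf : R := 2^-1.
have h12 : 0 < hf < 1 by rewrite invr_gt0 ltr0n invf_lt1 ?ltr1n.
have circ1 : (x hf / r) ^+ 2 + (y hf / r) ^+ 2 = 1.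
  by rewrite !expr_div_n -mulrDl circ// divff.
have [al [al1 al2]] := exists_angle circ1.
pose th t := al - I hf + I t.
have dth (t : R) : 0 < t < 1 -> is_derive t 1 th (om t).
  move=> ht; have h := dI _ ht; apply: is_derive_eq; rewrite /GRing.scale/=; ring.
have cth : {within `[0, 1], continuous th}.
  move=> t; apply: cvgD; first exact: cvg_cst.
  exact: (parameterized_integral_continuous ler01 iom).
(* The velocity is orthogonal to the radius; it is therefore [om t] times the rotated radius (-y,
   x), which is the content of [dx] and [dy]. *)
have dC (t : R) : 0 < t < 1 -> x t * derive1 x t + y t * derive1 y t = 0.
  move=> ht; have [|h1 h2] := dxy t; first by case/andP: ht => *; rewrite !ltW.
  have h3 : is_derive t 1 x (derive1 x t) by exact: is_derive_derive1.
  have h4 : is_derive t 1 y (derive1 y t) by exact: is_derive_derive1.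
  have h5 : is_derive t 1 (fun s => x s ^+ 2 + y s ^+ 2)
      (2 * (x t * derive1 x t + y t * derive1 y t)).
    by apply: is_derive_eq; rewrite /GRing.scale/=; ring.
  have h6 : is_derive t 1 (fun s => x s ^+ 2 + y s ^+ 2) 0.
    have h0 : is_derive t 1 (cst (r ^+ 2) : R -> R) 0 by exact: is_derive_cst.
    apply: near_eq_is_derive h0.
    have : t \in `]0, 1[%R by rewrite in_itv.
    by move/near_in_itvoo; apply: filterS => s; rewrite in_itv/= => /circ ->.
  have := @derive_val _ _ _ _ _ _ _ h5; rewrite (@derive_val _ _ _ _ _ _ _ h6).
  by move/esym/eqP; rewrite mulf_eq0 pnatr_eq0/= => /eqP.
have dx (t : R) : 0 < t < 1 -> is_derive t 1 x (- y t * om t).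
  move=> ht; have [|h1 h2] := dxy t; first by case/andP: ht => *; rewrite !ltW.
  apply: is_derive_derive1 => //; have e := dC _ ht; have c := circ _ ht.
  rewrite /om mulrA; apply: (canRL (mulfK r20)).
  rewrite -c; transitivity (x t * (x t * derive1 x t) + y t ^+ 2 * derive1 x t); first by ring.
  have -> : x t * derive1 x t = - (y t * derive1 y t) by apply/eqP; rewrite -addr_eq0 e.
  by ring.
have dy (t : R) : 0 < t < 1 -> is_derive t 1 y (x t * om t).
  move=> ht; have [|h1 h2] := dxy t; first by case/andP: ht => *; rewrite !ltW.
  apply: is_derive_derive1 => //; have e := dC _ ht; have c := circ _ ht.
  rewrite /om mulrA; apply: (canRL (mulfK r20)).
  rewrite -c; transitivity (x t ^+ 2 * derive1 y t + y t * (y t * derive1 y t)); first by ring.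
  have -> : y t * derive1 y t = - (x t * derive1 x t) by apply/eqP; rewrite -addr_eq0 addrC e.
  by ring.
(* The squared distance from the arc to the point of angle [th t]. Both points turn with the same
   angular velocity, so it is constant, and it vanishes at [hf] by the choice of [al]. *)
pose Q t := (x t - r * cos (th t)) ^+ 2 + (y t - r * sin (th t)) ^+ 2.
have dQ (t : R) : 0 < t < 1 -> is_derive t 1 Q 0.
  move=> ht; have h1 := dx _ ht; have h2 := dy _ ht; have h3 := dth _ ht.
  have h4 : is_derive t 1 (fun s => cos (th s)) (- sin (th t) * om t).
    exact: (@is_derive1_comp _ (@cos R)).
  have h5 : is_derive t 1 (fun s => sin (th s)) (cos (th t) * om t).
    exact: (@is_derive1_comp _ (@sin R)).
  apply: is_derive_eq; rewrite /GRing.scale/=; ring.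
have Q0 (t : R) : 0 < t < 1 -> Q t = 0.
  move=> ht; rewrite (derive0_cst_oo dQ ht h12) /Q /th subrK -al1 -al2.
  by rewrite ![r * (_ / r)]mulrC !divfK ?gt_eqF// !subrr expr0n addr0.
have pol (t : R) : 0 < t < 1 -> x t = r * cos (th t) /\ y t = r * sin (th t).
  move=> /Q0 /eqP; rewrite paddr_eq0 ?sqr_ge0// !sqrf_eq0 !subr_eq0.
  by move=> /andP[/eqP ? /eqP].
have thi : {in `]0, 1[ &, injective th}.
  move=> s t; rewrite !in_itv/= => hs ht st; apply: inj => //.
  by have [-> ->] := pol _ hs; have [-> ->] := pol _ ht; rewrite st.
have sub01 : [set` `]0, 1[%R] `<=` [set` `[0, 1]%R : interval R] := @subset_itv_oo_cc _ _ _ _.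
have iom' : mu.-integrable `]0, 1[ (EFin \o om) by exact: integrableS iom.
have int01 : (\int[mu]_(t in `]0%R, 1%R[) (om t)%:E = (th 1 - th 0)%:E)%E.
  have -> : th 1 - th 0 = I 1.
    have I0 : I 0 = 0 by rewrite /I set_itv1 Rintegral_set1.
    by rewrite /th I0; ring.
  rewrite /I /Rintegral fineK; last exact: integrable_fin_num.
  by rewrite -(integral_itv_bndoo true false)//; exact: measurable_int iom'.
exists (Num.min (th 0) (th 1)), (Num.max (th 0) (th 1)).
have cth' : {within `]0, 1[, continuous th} by exact: continuous_subspaceW cth.
have main : (\int[mu]_(t in `]0%R, 1%R[) (`|om t|)%:E = `|th 1 - th 0|%:E)%E.
  have dth1 (t : R) : t \in `]0, 1[%R -> derivable th t 1.
    by rewrite in_itv/= => /dth[].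
  have dth2 (t : R) : t \in `]0, 1[%R -> om t = derive1 th t.
    by rewrite in_itv/= => /dth[_ <-]; rewrite derive1E.
  (* Monotonicity of [th] gives [om] a constant sign, so the absolute value comes out of the
     integral. *)
  have [up|down] := itv_continuous_inj_mono cth' thi.
    have om0 (t : R) : t \in `]0, 1[%R -> 0 <= om t.
      move=> ht; rewrite dth2//; apply: (incr_derive1_ge0_itv _ up ht).
      by move=> s; rewrite inE; exact: dth1.
    transitivity (\int[mu]_(t in `]0%R, 1%R[) (om t)%:E)%E; last first.
      rewrite int01 ger0_norm// -lee_fin -int01; apply: integral_ge0 => t ht.
      by rewrite lee_fin om0.
    by apply: eq_integral => t; rewrite inE/= => /om0 h; rewrite ger0_norm.
  have om0 (t : R) : t \in `]0, 1[%R -> om t <= 0.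
    move=> ht; rewrite dth2//; apply: (decr_derive1_le0_itv _ down ht).
    by move=> s; rewrite inE; exact: dth1.
  have intN : (\int[mu]_(t in `]0%R, 1%R[) (- (om t)%:E) = (- (th 1 - th 0))%:E)%E.
    by rewrite integralN/= ?int01//; exact: integrable_add_def.
  transitivity (\int[mu]_(t in `]0%R, 1%R[) (- (om t)%:E))%E; last first.
    rewrite intN ler0_norm// -oppr_ge0 -lee_fin -intN; apply: integral_ge0 => t ht.
    by rewrite -EFinN lee_fin oppr_ge0 om0.
  by apply: eq_integral => t; rewrite inE/= => /om0 h; rewrite ler0_norm.
have ivt (u : R) : Num.min (th 0) (th 1) < u < Num.max (th 0) (th 1) -> exists2 t, 0 < t <
  1 & th t = u.
  move=> /andP[u1 u2].
  have [|t] := @IVT _ th 0 1 u ler01 cth; first by rewrite !ltW.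
  rewrite in_itv/= => /andP[t0 t1] tu; exists t => //.
  rewrite !lt_neqAle t0 t1 !andbT; apply/andP; split; apply/eqP => e.
    by move: u1 u2; rewrite -tu -e gt_min lt_max ltxx/=; case: ltgtP.
  by move: u1 u2; rewrite -tu e gt_min lt_max ltxx/= !orbF; case: ltgtP.
split.
- by rewrite ge_min le_max lexx.
- apply: measurableT_comp; first exact: normr_measurable.
  by apply/measurable_EFinP; exact: measurable_int iom'.
- rewrite main; congr EFin; have [h|h] := leP (th 0) (th 1).
    by rewrite ger0_norm// subr_ge0.
  by rewrite ltr0_norm ?subr_lt0// opprB.
- move=> u /ivt[t ht <-]; exists t => //; exact: pol.
move=> u v /ivt[t ht <-] /ivt[s hs <-] cc ss; congr th; apply: inj => //.
by have [-> ->] := pol _ hs; have [-> ->] := pol _ ht; rewrite cc ss.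
Qed.

End ArcLift.

(** * The level integrals of the plane *)

Section LevelIntegral.
Context {R : realType}.
Local Notation mu := (@lebesgue_measure R).
Local Notation Re := (@complex.Re R).
Local Notation Im := (@complex.Im R).

Lemma d_dx_ln_modulus (z : CC R) : z != 0 ->
  d_dx (fun w : CC R => ln (modulus w)) z = Re z / modulus z ^+ 2.
Proof.
by move=> z0; rewrite /d_dx rderiv_ln_modulus// modulus_sqr/= mul1r mul0r addr0.
Qed.

Lemma d_dy_ln_modulus (z : CC R) : z != 0 ->
  d_dy (fun w : CC R => ln (modulus w)) z = Im z / modulus z ^+ 2.
Proof.
by move=> z0; rewrite /d_dy rderiv_ln_modulus// modulus_sqr/= mul1r mul0r add0r.
Qed.

(** On |z| = r the form d^c log |z| is d theta / (4 pi). The angle intervals of disjoint arcs have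
    total length at most 2 pi, whence the bound c (2 pi) / (4 pi). *)
Lemma level_integral_plane_le (g : CC R -> R) (c r : R) : 0 < r -> 0 <= c ->
  (forall y, modulus y = r -> g y = c) ->
  (level_integral (Y := complex_plane R) (@modulus R) g r <= (c / 2)%:E)%E.
Proof.
move=> r0 c0 gc; apply: ge_ereal_sup => _ [n [p [x [y [arcs disj ->]]]]].
have lev j (t : R) : 0 < t < 1 -> modulus (x j t +i* y j t : CC R) = r.
  by move=> ht; have [_ _ _ _ /(_ _ ht)[z [_ zr] <-]] := arcs j.
have lev2 j (t : R) : 0 < t < 1 -> x j t ^+ 2 + y j t ^+ 2 = r ^+ 2.
  by move=> ht; rewrite -(lev j _ ht) modulus_sqr.
have ex j : exists ab : R * R, [/\ ab.1 <= ab.2,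
    measurable_fun (`]0, 1[%classic : set R) (fun t =>
      `| (x j t * derive1 (y j) t - y j t * derive1 (x j) t) / r ^+ 2 | : R),
    (\int[mu]_(t in `]0%R, 1%R[)
       (`| (x j t * derive1 (y j) t - y j t * derive1 (x j) t) / r ^+ 2 |)%:E = (ab.2 - ab.1)%:E)%E,
    (forall u, ab.1 < u < ab.2 ->
       exists2 t, 0 < t < 1 & x j t = r * cos u /\ y j t = r * sin u) &
    (forall u v, ab.1 < u < ab.2 -> ab.1 < v < ab.2 -> cos u = cos v -> sin u = sin v -> u = v)].
  have [dxy cx cy inj _] := arcs j.
  by have [a [b H]] := arc_lift r0 dxy cx cy inj (lev2 j); exists (a, b).
have [ab abP] := choice ex.
have pack : \sum_j ((ab j).2 - (ab j).1) <= 2 * pi.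
  apply: circle_packing => [j|j k u v hu hv cuv suv]; first by have [h _ _ _ _] := abP j; exact: h.
  have [_ _ _ pj ij] := abP j; have [_ _ _ pk ik] := abP k.
  (* Equal angles mean a common point of the two arcs: disjointness forces the same arc, and within
     one arc the angle determines the point of the interval. *)
  suff jk : j = k by split => //; move: hv; rewrite -jk => hv; exact: ij.
  have [t ht [xt yt]] := pj _ hu; have [s hs [xs ys]] := pk _ hv.
  apply: (disj j k) => //; exists (x j t +i* y j t); split.
    by exists t.
  by exists s; [rewrite /= in_itv/=|rewrite /= xt yt xs ys cuv suv].
rewrite (eq_bigr (fun j => ((c / (4 * pi)) * ((ab j).2 - (ab j).1))%:E)); last first.
  move=> j _; have [_ mj intj _ _] := abP j.
  rewrite EFinM -intj -ge0_integralZl_EFin//; last 2 first.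
  - by apply/measurable_EFinP.
  - by rewrite divr_ge0// mulr_ge0// pi_ge0.
  apply: eq_integral => t; rewrite inE/= in_itv/= => ht.
  have z0 : (x j t +i* y j t : CC R) != 0 by rewrite -modulus_gt0 lev.
  rewrite gc ?lev// /dc_along d_dx_ln_modulus// d_dy_ln_modulus// lev//=.
  rewrite -EFinM; congr EFin.
  set X := x j t; set Y := y j t; set X' := derive1 (x j) t; set Y' := derive1 (y j) t.
  have -> : (X / r ^+ 2 * Y' - Y / r ^+ 2 * X') / (4 * pi) =
      (4 * pi)^-1 * ((X * Y' - Y * X') / r ^+ 2).
    have p0 : pi != 0 :> R by rewrite gt_eqF// pi_gt0.
    have r1 : r != 0 by rewrite gt_eqF.
    by move: p0; generalize (pi : R) => P P0; field; rewrite r1 P0.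
  by rewrite normrM [`|(4 * pi)^-1|]ger0_norm ?mulrA// invr_ge0 mulr_ge0// pi_ge0.
rewrite sumEFin lee_fin -mulr_sumr.
have -> : c / 2 = c / (4 * pi) * (2 * pi).
  by have := gt_eqF (pi_gt0 R); generalize (pi : R) => P P0; field; rewrite P0.
by apply: ler_wpM2l => //; rewrite divr_ge0// mulr_ge0// pi_ge0.
Qed.

Lemma varsigma_plane_le : varsigma (Y := complex_plane R) (@modulus R) <= 1 / 2.
Proof.
rewrite /varsigma.
set F := (X in lim X).
(* Without convergence [lim] is the default point, and [fine] sends it to 0, which satisfies the
   bound as well. *)
have [cF|/dvgP ->] := pselect (cvg F); last by rewrite /= divr_ge0.
have : (lim F <= (1 / 2 : R)%:E)%E.
  apply: lime_le => //.
  exists 1; split=> // r r1; apply: level_integral_plane_le => //.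
  exact: lt_trans r1.
by case: (lim F) => [l| |]//=; rewrite divr_ge0.
Qed.

(** Derived from log |z| by writing |w| as exp (log |w|) away from 0. *)
Lemma rderiv_modulus (a z : CC R) : z != 0 ->
  rderiv a (@modulus R) z = (Re a * Re z + Im a * Im z) / modulus z.
Proof.
move=> z0.
have zline : z + (0 : R)%:C *: a = z by rewrite scale0r addr0.
rewrite (rderiv_eq (u' := fun w => expR (ln (modulus w))) _ (@open_neq_plane R 0))//; last first.
  by move=> w w0; rewrite lnK// posrE modulus_gt0.
have h1 := is_derive_ln_modulus a z0.
have h2 := is_derive_expR (ln (modulus (z + (0 : R)%:C *: a))).
have h3 := @is_derive1_comp R expR (fun t : R => ln (modulus (z + t%:C *: a))) 0 _ _ h2 h1.
rewrite /rderiv derive1E (@derive_val _ _ _ _ _ _ _ h3) zline lnK ?posrE ?modulus_gt0//.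
by rewrite -modulus_sqr; field; rewrite gt_eqF// modulus_gt0.
Qed.

Lemma d_dx_modulus (z : CC R) : z != 0 -> d_dx (@modulus R) z = Re z / modulus z.
Proof. by move=> z0; rewrite /d_dx rderiv_modulus//= mul1r mul0r addr0. Qed.

Lemma d_dy_modulus (z : CC R) : z != 0 -> d_dy (@modulus R) z = Im z / modulus z.
Proof. by move=> z0; rewrite /d_dy rderiv_modulus//= mul1r mul0r add0r. Qed.

(** Since |d sigma (d/dz)|^2 = 1/4, the integrand is the constant ln 4; the other factor 1/2 bounds
    the mass of the circle. *)
Lemma E_sigma_plane_le (xi : complex_plane R -> CC R) (r : R) :
  xi = (fun=> 1) -> 0 < r ->
  (E_sigma (Y := complex_plane R) (@modulus R) xi r <= (ln 4 / 2 : R)%:E)%E.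
Proof.
move=> -> r0; apply: level_integral_plane_le => //.
  by rewrite ln_ge0// ler1n.
move=> y yr; have y0 : y != 0 by rewrite -modulus_gt0 yr.
have -> : modulus (dsigma_xi (Y := complex_plane R) (@modulus R) (fun=> 1) y) ^+ 2 = 4^-1.
  rewrite modulus_sqr /dsigma_xi mul1r /=.
  rewrite /coord /= d_dx_modulus// d_dy_modulus//.
  rewrite !expr_div_n sqrrN !expr_div_n -!mulrDl -modulus_sqr.
  by field; rewrite gt_eqF// modulus_gt0.
by rewrite /log_minus lnV ?posrE// min_r ?opprK// oppr_le0 ln_ge0// ler1n.
Qed.

End LevelIntegral.

(** * Rational homology of a disc *)

Section ChainAlgebra.
Context {R : realType} {T : topologicalType}.
Local Notation chain := (@chain R T).

Definition invariant_pred n (P : ('rV[R]_n.+1 -> T) -> bool) :=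
  forall s s', same_simplex s s' -> P s = P s'.

(** Chains are lists identified through their coefficients. The functionals [mass P], for P
    depending only on the restriction to the standard simplex, respect this identification; they
    include the coefficients themselves and, for [xpredT], the augmentation. *)
Definition mass n (P : ('rV[R]_n.+1 -> T) -> bool) (c : chain n) : rat :=
  \sum_(a <- c | P a.2) a.1.

Lemma same_simplex_refl n (s : 'rV[R]_n.+1 -> T) : same_simplex s s.
Proof. by []. Qed.

Lemma same_simplex_sym n (s s' : 'rV[R]_n.+1 -> T) : same_simplex s s' -> same_simplex s' s.
Proof. by move=> h v /h ->. Qed.

Lemma same_simplex_trans n (s1 s2 s3 : 'rV[R]_n.+1 -> T) :
  same_simplex s1 s2 -> same_simplex s2 s3 -> same_simplex s1 s3.
Proof. by move=> h1 h2 v Sv; rewrite h1// h2. Qed.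

Lemma invariant_same n (s : 'rV[R]_n.+1 -> T) : invariant_pred (fun s' => `[< same_simplex s' s >]).
Proof.
move=> s1 s2 h; apply/asboolP/asboolP => h'.
  by apply: same_simplex_trans h'; exact: same_simplex_sym.
exact: same_simplex_trans h h'.
Qed.

Lemma coefE n (c : chain n) s : coef c s = mass (fun s' => `[< same_simplex s' s >]) c.
Proof. by []. Qed.

Lemma mass_cat n (P : ('rV[R]_n.+1 -> T) -> bool) (c d : chain n) :
  mass P (c ++ d) = mass P c + mass P d.
Proof. by rewrite /mass big_cat. Qed.

Lemma mass_scale n (P : ('rV[R]_n.+1 -> T) -> bool) k (c : chain n) :
  mass P (scale_chain k c) = k * mass P c.
Proof. by rewrite /mass big_map /= mulr_sumr. Qed.

Lemma mass_comb n k (P : ('rV[R]_n.+1 -> T) -> bool) (a : 'I_k -> rat) (z : 'I_k -> chain n) :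
  mass P (flatten [seq scale_chain (a j) (z j) | j <- enum 'I_k]) =
  \sum_j a j * mass P (z j).
Proof.
rewrite -big_enum; elim: (enum 'I_k) => [|j l IH] /=; first by rewrite /mass !big_nil.
by rewrite mass_cat mass_scale IH big_cons.
Qed.

(** Induction on the length: P is constant on the entries that carry the same simplex as the head,
    and their weights add up to a zero coefficient. Removing them leaves a shorter chain whose
    coefficients are still zero. *)
Lemma mass0 n (P : ('rV[R]_n.+1 -> T) -> bool) (c : chain n) : invariant_pred P ->
  chain_eq c [::] -> mass P c = 0.
Proof.
move=> invP; have [m] := ubnP (size c); elim: m c => // m IH [|a c].
  by rewrite /mass big_nil.
move=> /= cm c0.
pose same b := `[< same_simplex b a.2 >].
pose c' := [seq b <- c | ~~ same b.2].
have split Q : mass Q (a :: c) = mass (fun s => Q s && same s) (a :: c) + mass Q c'.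
  rewrite /mass big_filter_cond /= [LHS](bigID (fun b => same b.2)) /=; congr (_ + _).
  rewrite big_cons; have -> : same a.2 by apply/asboolP; exact: same_simplex_refl.
  by rewrite andbF; apply: eq_bigl => b; rewrite andbC.
have sames Q : invariant_pred Q -> mass (fun s => Q s && same s) (a :: c) = 0.
  move=> invQ; case Qa: (Q a.2); last first.
    rewrite /mass big1// => b /andP[Qb /asboolP sb].
    by rewrite (invQ _ _ sb) Qa in Qb.
  have := c0 a.2; rewrite [RHS]/coef big_nil => <-; rewrite coefE.
  apply: eq_bigl => b; rewrite -/(same b.2); case sb: (same b.2); last by rewrite andbF.
  by move/asboolP: sb => sb; rewrite (invQ _ _ sb) Qa.
rewrite split sames// add0r; apply: IH.
  by apply: leq_ltn_trans (cm : (size c < m)%N); rewrite size_filter count_size.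
move=> s; rewrite coefE [RHS]/coef big_nil.
have := c0 s; rewrite [RHS]/coef big_nil coefE split sames ?add0r//.
exact: invariant_same.
Qed.

Lemma mass_eq n (P : ('rV[R]_n.+1 -> T) -> bool) (c d : chain n) : invariant_pred P ->
  chain_eq c d -> mass P c = mass P d.
Proof.
move=> invP cd; apply/eqP; rewrite -subr_eq0 -mulN1r -mass_scale -mass_cat.
apply/eqP/mass0 => // s; rewrite !coefE mass_cat mass_scale -!coefE cd mulN1r subrr.
by rewrite /coef big_nil.
Qed.

Lemma mass_boundary n (P : ('rV[R]_n.+1 -> T) -> bool) (c : chain n.+1) :
  mass P (boundary c) = \sum_(a <- c) \sum_(i < n.+2)
    (if P (a.2 \o @face_map R n i) then (-1) ^+ (i : nat) * a.1 else 0).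
Proof.
rewrite /boundary; elim: c => [|a c IH] /=; first by rewrite /mass !big_nil.
rewrite mass_cat IH big_cons; congr (_ + _).
by rewrite /mass big_map /= -[RHS]big_enum -big_mkcond.
Qed.

Lemma chain_in_comb (A : set T) n k (a : 'I_k -> rat) (z : 'I_k -> chain n) :
  (forall j, chain_in A (z j)) ->
  chain_in A (flatten [seq scale_chain (a j) (z j) | j <- enum 'I_k]).
Proof.
move=> zA b /flatten_mapP[j _] /mapP[b' b'z ->] /=; exact: (zA j b').
Qed.

End ChainAlgebra.

(** * The cone operator and star-shaped sets *)

Section Cone.
Context {R : realType}.
Implicit Types A : set (CC R).

(** Projection of the simplex from its vertex 0 onto the opposite face, in barycentric
    coordinates. *)
Definition cone_base n (v : 'rV[R]_n.+2) : 'rV[R]_n.+1 :=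
  \row_j (v ord0 (lift ord0 j) / (1 - v ord0 ord0)).

(* The cone over a simplex with vertex 0; at the vertex, where cone_base is a division
   by zero, the factor 1 - v_0 vanishes. *)
Definition cone_simplex n (s : 'rV[R]_n.+1 -> CC R) (v : 'rV[R]_n.+2) : CC R :=
  (1 - v ord0 ord0)%:C * s (cone_base v).

Definition cone_chain n (c : @chain R (CC R) n) : @chain R (CC R) n.+1 :=
  [seq (a.1, cone_simplex a.2) | a <- c].

Lemma cone_face0 n (s : 'rV[R]_n.+1 -> CC R) : cone_simplex s \o @face_map R n ord0 = s.
Proof.
apply/funext => v; rewrite /cone_simplex /= mxE unlift_none subr0 mul1r; congr s.
by apply/rowP => j; rewrite !mxE unlift_none liftK subr0 divr1.
Qed.

Lemma cone_faceS n (s : 'rV[R]_n.+2 -> CC R) (i : 'I_n.+2) :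
  cone_simplex s \o @face_map R n.+1 (lift ord0 i) = cone_simplex (s \o @face_map R n i).
Proof.
apply/funext => v; rewrite /cone_simplex /=.
have e0 : @face_map R n.+1 (lift ord0 i) v ord0 ord0 = v ord0 ord0.
  rewrite mxE; have -> : ord0 = lift (lift ord0 i) (ord0 : 'I_n.+2) by apply/val_inj.
  by rewrite liftK.
rewrite e0; congr (_ * s _).
apply/rowP => j; rewrite [LHS]mxE e0 [RHS]mxE [X in X / _]mxE.
case: (unliftP i j) => [k|] ->.
  have -> : lift ord0 (lift i k) = lift (lift ord0 i) (lift ord0 k) :> 'I_n.+3.
    by apply/val_inj; rewrite /= /bump /= !add1n ltnS addnS.
  by rewrite liftK !mxE.
by rewrite unlift_none mul0r.
Qed.

Lemma cone_base_simplex n (v : 'rV[R]_n.+2) :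
  std_simplex v -> v ord0 ord0 < 1 -> std_simplex (cone_base v).
Proof.
move=> [v0 v1] lt1; have p : 0 < 1 - v ord0 ord0 by rewrite subr_gt0.
split=> [i|]; first by rewrite mxE divr_ge0// ltW.
under eq_bigr do rewrite mxE.
rewrite -mulr_suml; move: v1; rewrite big_ord_recl => e.
have -> : \sum_(i < n.+1) v ord0 (lift ord0 i) = 1 - v ord0 ord0 by rewrite -e addrC addKr.
by rewrite divff// gt_eqF.
Qed.

Lemma simplex_le1 n (v : 'rV[R]_n.+1) i : std_simplex v -> v ord0 i <= 1.
Proof.
move=> [v0 <-]; rewrite (bigD1 i)//= lerDl; apply: sumr_ge0 => j _; exact: v0.
Qed.

Lemma same_cone n (s s' : 'rV[R]_n.+1 -> CC R) :
  same_simplex s s' -> same_simplex (cone_simplex s) (cone_simplex s').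
Proof.
move=> h v Sv; rewrite /cone_simplex.
have := simplex_le1 ord0 Sv; rewrite le_eqVlt => /predU1P[->|lt1].
  by rewrite subrr !mul0r.
by rewrite h//; exact: cone_base_simplex.
Qed.

(** The standard 0-simplex is the point 1, where the factor [1 - v_0] vanishes. This face reduced to
    the vertex is what creates the augmentation term of degree 0. *)
Lemma cone_face1 (s : 'rV[R]_1 -> CC R) :
  same_simplex (cone_simplex s \o @face_map R 0 (lift ord0 ord0)) (fun=> 0).
Proof.
move=> v [_]; rewrite big_ord1 => v1; rewrite /cone_simplex /=.
rewrite mxE; have -> : ord0 = lift (lift ord0 ord0) (ord0 : 'I_1) by apply/val_inj.
by rewrite liftK v1 subrr mul0r.
Qed.

Lemma continuous_cone_base n (v : 'rV[R]_n.+2) : v ord0 ord0 != 1 -> {for v, continuous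
  (@cone_base n)}.
Proof.
move=> v1 A [P nP PA].
have : \forall w \near v, forall j : 'I_n.+1, P ord0 j (cone_base w ord0 j).
  apply: (@filter_forall _ 'I_n.+1 (fun j w => P ord0 j (cone_base w ord0 j)) (nbhs v)) => j.
  have : (cone_base w ord0 j) @[w --> v] --> cone_base v ord0 j.
    rewrite mxE; under eq_fun do rewrite mxE.
    apply: (@cvgM _ _ (nbhs v)); first exact: coord_continuous.
    apply: cvgV; first by rewrite subr_eq0 eq_sym.
    by apply: (@cvgB _ R _ (nbhs v)); [exact: cvg_cst|exact: coord_continuous].
  by apply; exact: nP.
by apply: filterS => w Pw; apply: PA => i j; rewrite ord1.
Qed.

(** At the vertex [cone_base] has no limit, but the cone is squeezed by (1 - v_0) M; elsewhere it is
    built from continuous maps. *)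
Lemma cone_continuous A (M : R) n (s : 'rV[R]_n.+1 -> CC R) :
  (forall z, A z -> modulus z <= M) ->
  {within @std_simplex R n, continuous s} ->
  (forall v, std_simplex v -> A (s v)) ->
  {within @std_simplex R n.+1, continuous (cone_simplex s)}.
Proof.
move=> AM /subspace_continuousP cs sA; apply/subspace_continuousP => v Sv.
have c0 : (fun w : 'rV[R]_n.+2 => (1 - w ord0 ord0)%:C : CC R) @ v --> ((1 - v ord0
  ord0)%:C : CC R).
  apply: (@continuous_comp _ _ _ (fun w : 'rV[R]_n.+2 => 1 - w ord0 ord0)
            (fun t : R => t%:C : CC R)); last exact: real_complex_continuous.
  by apply: (@cvgB _ R _ (nbhs v)); [exact: cvg_cst|exact: coord_continuous].
have := simplex_le1 ord0 Sv; rewrite le_eqVlt => /predU1P[v1|lt1].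
  have e : cone_simplex s v = 0 by rewrite /cone_simplex v1 subrr mul0r.
  suff : cone_simplex s w @[w --> within (@std_simplex R n.+1) (nbhs v)] --> (0 : CC R) by
    rewrite -e.
  apply: cvg_modulus.
  apply: (@squeeze_cvgr _ _ _ _ (fun=> 0) (fun w : 'rV[R]_n.+2 => (1 - w ord0 ord0) * M)).
  - have : within (@std_simplex R n.+1) (nbhs v) (@std_simplex R n.+1) by exact: withinT.
    apply: filterS => w Sw; rewrite modulus_ge0 /= /cone_simplex.
    have := simplex_le1 ord0 Sw; rewrite le_eqVlt => /predU1P[->|lt1].
      by rewrite subrr !mul0r subr0 modulus_real normr0.
    have p : 0 <= 1 - w ord0 ord0 by rewrite subr_ge0 ltW.
    rewrite sub0r modulusN modulusM modulus_real (ger0_norm p).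
    by apply: ler_wpM2l => //; apply/AM/sA/cone_base_simplex.
  - exact: cvg_cst.
  - have <- : (1 - v ord0 ord0) * M = 0 by rewrite v1 subrr mul0r.
    apply: (@cvgM _ _ (within (@std_simplex R n.+1) (nbhs v))); last exact: cvg_cst.
    apply: cvg_within_filter.
    by apply: (@cvgB _ R _ (nbhs v)); [exact: cvg_cst|exact: coord_continuous].
apply: (@cvgM _ _ (within (@std_simplex R n.+1) (nbhs v))).
  exact: cvg_within_filter.
apply: (@cvg_comp _ _ _ (@cone_base n) s _ (within (@std_simplex R n) (nbhs (cone_base v)))).
  move=> B /= SB.
  have n1 : nbhs v (fun w : 'rV[R]_n.+2 => w ord0 ord0 < 1).
    have : (fun w : 'rV[R]_n.+2 => w ord0 ord0) @ v --> v ord0 ord0 by exact: coord_continuous.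
    by move/(cvgr_lt _); apply.
  have n2 : nbhs v (fun w : 'rV[R]_n.+2 => std_simplex (cone_base w) -> B (cone_base w)).
    by apply: continuous_cone_base SB; rewrite lt_eqF.
  apply: filterS2 n1 n2 => w w1 wB Sw; apply: wB; exact: cone_base_simplex.
exact/cs/cone_base_simplex.
Qed.
Lemma invariant_cone n (P : ('rV[R]_n.+2 -> CC R) -> bool) :
  invariant_pred P -> invariant_pred (fun s : 'rV[R]_n.+1 -> CC R => P (cone_simplex s)).
Proof. by move=> invP s s' ss'; apply: invP; exact: same_cone. Qed.

(** The homotopy formula for the cone operator C: the boundary of C c is c minus C applied to the
    boundary of c. *)
Lemma mass_boundary_coneS n (P : ('rV[R]_n.+2 -> CC R) -> bool) (c : @chain R (CC R) n.+1) :
  mass P (boundary (cone_chain c)) = mass P c - mass (fun s => P (cone_simplex s)) (boundary c).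
Proof.
rewrite !mass_boundary big_map [mass P c]/mass [X in X - _]big_mkcond -sumrB.
apply: eq_bigr => a _ /=.
rewrite big_ord_recl cone_face0 expr0 mul1r; congr (_ + _).
rewrite -sumrN; apply: eq_bigr => i _.
rewrite cone_faceS lift0 exprS mulN1r mulNr.
by case: ifP; rewrite ?oppr0.
Qed.

(** In degree 0 the correction term of the homotopy formula is the augmentation of c times the
    constant simplex 0. *)
Lemma mass_boundary_cone0 (P : ('rV[R]_1 -> CC R) -> bool) (c : @chain R (CC R) 0) :
  invariant_pred P ->
  mass P (boundary (cone_chain c)) =
  mass P c - (if P (fun=> 0) then mass xpredT c else 0).
Proof.
move=> invP; rewrite !mass_boundary big_map /mass [X in X - _]big_mkcond.
have -> : (if P (fun=> 0) then \sum_(a <- c) a.1 else 0) =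
    \sum_(a <- c) (if P (fun=> 0) then a.1 else 0).
  by case: ifP => // _; rewrite big1.
rewrite -sumrB; apply: eq_bigr => a _ /=.
rewrite big_ord_recl cone_face0 expr0 mul1r big_ord1; congr (_ + _).
rewrite (invP _ _ (@cone_face1 a.2)) lift0 expr1 mulN1r.
by case: ifP; rewrite ?oppr0.
Qed.

Lemma mass_boundary1 (c : @chain R (CC R) 1) : mass xpredT (boundary c) = 0.
Proof.
rewrite mass_boundary big1// => a _; rewrite !big_ord_recl big_ord0 /= expr0 mul1r.
by rewrite /bump /= expr1 mulN1r addr0 subrr.
Qed.

Section StarShaped.
Variables (A : set (CC R)) (M : R).
Hypothesis AM : forall z, A z -> modulus z <= M.
Hypothesis A0 : A 0.
Hypothesis starA : forall (t : R) z, 0 <= t <= 1 -> A z -> A (t%:C * z).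

Lemma cone_chain_in n (c : @chain R (CC R) n) : chain_in A c -> chain_in A (cone_chain c).
Proof.
move=> cA b /mapP[a ac ->] /=; have [ca aA] := cA a ac; split.
  exact: cone_continuous AM ca aA.
move=> v Sv; have := simplex_le1 ord0 Sv; rewrite le_eqVlt => /predU1P[v1|lt1].
  by rewrite /cone_simplex v1 subrr mul0r.
apply: starA; last by apply: aA; exact: cone_base_simplex.
by have [/(_ ord0) v0 _] := Sv; lra.
Qed.

Let comb n k (a : 'I_k -> rat) (z : 'I_k -> @chain R (CC R) n) :=
  flatten [seq scale_chain (a j) (z j) | j <- enum 'I_k].

Lemma mass_boundary_comb n k (a : 'I_k -> rat) (z : 'I_k -> @chain R (CC R) n.+1) P :
  mass P (boundary (comb a z)) = \sum_j a j * mass P (boundary (z j)).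
Proof.
rewrite -big_enum /comb; elim: (enum 'I_k) => [|j l IH] /=; first by rewrite /mass !big_nil.
rewrite /boundary map_cat flatten_cat -/(boundary _) mass_cat big_cons; congr (_ + _) => //.
rewrite -/(boundary _) !mass_boundary big_map mulr_sumr; apply: eq_bigr => b _ /=.
rewrite mulr_sumr; apply: eq_bigr => i _.
by case: ifP; rewrite ?mulr0// mulrCA.
Qed.

(** By the homotopy formula a cycle of positive degree is the boundary of its cone. The combination
    with all coefficients 1 is thus a boundary, which independence allows only for an empty
    family. *)
Lemma independent_positive n k (z : 'I_k -> @chain R (CC R) n.+1) :
  independent_cycles A z -> k = 0%N.
Proof.
move=> [zA ind]; apply/eqP; rewrite -leqn0 leqNgt; apply/negP => k0.
suff : (1 : rat) = 0 by move/eqP; rewrite oner_eq0.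
apply: (ind (fun=> 1) _ (Ordinal k0)).
exists (cone_chain (comb (fun=> 1) z)); split.
  by apply: cone_chain_in; apply: chain_in_comb => j; have [] := zA j.
move=> s; rewrite !coefE mass_boundary_coneS.
rewrite (mass0 (invariant_cone (invariant_same s))) ?subr0//.
move=> s'; rewrite coefE mass_boundary_comb [RHS]/coef big_nil big1// => j _.
have [_ zj] := zA j; by rewrite (mass0 (invariant_same s')) ?mulr0.
Qed.

Lemma betti_positive n : betti A n.+1 = 0 :> R.
Proof.
rewrite /betti (_ : [set _ | _ in _] = [set 0]) ?sup1//.
apply/seteqP; split=> [_ [k [z /independent_positive ->] <-]//|_ ->].
exists 0%N => //=; exists (fun=> [::]); split; first by case.
by move=> a _; case.
Qed.

(** A 0-chain of zero augmentation bounds its cone. Among two 0-chains of augmentations e0 and e1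
    there is always a nontrivial combination of zero augmentation: (1, 0) if e0 = 0, and (e1, - e0)
    otherwise. *)
Lemma independent_zero k (z : 'I_k -> @chain R (CC R) 0) :
  independent_cycles A z -> (k <= 1)%N.
Proof.
move=> [zA ind]; rewrite leqNgt; apply/negP => k1.
pose e j := mass xpredT (z j).
have bound (a : 'I_k -> rat) : \sum_j a j * e j = 0 -> forall j, a j = 0.
  move=> ae; apply: ind; set c := flatten _.
  exists (cone_chain c); split.
    by apply: cone_chain_in; apply: chain_in_comb => j; have [] := zA j.
  move=> s; rewrite !coefE mass_boundary_cone0; last exact: invariant_same.
  have -> : mass xpredT c = 0 by rewrite /c mass_comb.
  by rewrite if_same subr0.
pose j0 : 'I_k := Ordinal (ltnW k1); pose j1 : 'I_k := Ordinal k1.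
have j01 : j0 != j1 by [].
have delta (i : 'I_k) (x : rat) : \sum_j (if j == i then x else 0) * e j = x * e i.
  rewrite (bigD1 i)//= eqxx big1 ?addr0// => j /negbTE ->.
  by rewrite mul0r.
have [e0|e0] := eqVneq (e j0) 0.
  have := bound (fun j => if j == j0 then 1 else 0); rewrite delta e0 mulr0.
  by move=> /(_ erefl j0); rewrite eqxx => /eqP; rewrite oner_eq0.
have := bound (fun j => (if j == j0 then e j1 else 0) + (if j == j1 then - e j0 else 0)).
under eq_bigr do rewrite mulrDl.
rewrite big_split /= !delta mulNr mulrC subrr => /(_ erefl j1).
rewrite eqxx eq_sym (negbTE j01) add0r => /eqP; rewrite oppr_eq0; exact/negP.
Qed.

(** The augmentation kills boundaries, because the two ends of an edge have opposite signs, whereas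
    it sends a times the point to a. *)
Lemma independent_point :
  independent_cycles A (fun _ : 'I_1 => [:: (1, fun=> 0)] : @chain R (CC R) 0).
Proof.
split=> [j|a [w [_ wb]] j].
  split=> // b; rewrite mem_seq1 => /eqP ->; split=> [|v _]; last exact: A0.
  by apply: continuous_subspaceT; exact: (@cst_continuous _ _ (0 : CC R)).
have := mass_eq (P := xpredT) (fun _ _ _ => erefl) wb.
rewrite mass_boundary1 mass_comb big_ord1 /mass big_seq1 mulr1 => e.
by rewrite (ord1 j) -e.
Qed.

Lemma betti_zero : betti A 0 = 1 :> R.
Proof.
rewrite /betti; set S := [set _ | _ in _].
have S1 : S 1 by exists 1%N => //=; eexists; exact: independent_point.
have ubS : ubound S 1 by move=> _ [k [z /independent_zero k1] <-]; rewrite (ler_nat R k 1).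
apply/eqP; rewrite eq_le; apply/andP; split.
  by apply: ge_sup => //; exists 1.
by apply: ub_le_sup => //; exists 1.
Qed.

Lemma euler_char_star : euler_char A = 1 :> R.
Proof. by rewrite /euler_char betti_zero !betti_positive subr0 addr0. Qed.

End StarShaped.
End Cone.

(** * The integrated Euler characteristic of discs *)

Section XSigma.
Context {R : realType}.
Local Notation mu := (@lebesgue_measure R).

Lemma integral_inv (a b : R) : 0 < a -> a <= b ->
  (\int[mu]_(t in `[a, b]) (t^-1)%:E = (ln b - ln a)%:E)%E.
Proof.
move=> a0; rewrite le_eqVlt => /predU1P[<-|ab].
  by rewrite set_itv1 integral_set1 subrr.
have pos (t : R) : a <= t -> 0 < t by exact: lt_le_trans.
have dln (t : R) : a <= t -> is_derive t 1 (@ln R) t^-1.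
  by move=> /pos; exact: is_derive1_ln.
have cln (t : R) : a <= t -> {for t, continuous (@ln R)}.
  by move=> /pos; exact: continuous_ln.
rewrite (@continuous_FTC2 R (fun t => t^-1) (@ln R) a b ab) ?EFinB//.
- apply: continuous_in_subspaceT => t; rewrite inE/= in_itv/= => /andP[/pos t0 _].
  by apply: inv_continuous; rewrite gt_eqF.
- split=> [t||].
  + by rewrite in_itv/= => /andP[/ltW/dln[]].
  + by apply: cvg_at_right_filter; exact: cln.
  + by apply: cvg_at_left_filter; apply: cln; exact: ltW.
- by move=> t; rewrite in_itv/= => /andP[/ltW/dln[_ <-] _]; rewrite derive1E.
Qed.

Lemma euler_char_disc (t : R) : 0 < t ->
  euler_char (sublevel (Y := complex_plane R) (@modulus R) t) = 1 :> R.
Proof.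
move=> t0; apply: (@euler_char_star _ _ t).
- by move=> z /ltW.
- suff : modulus (0 : CC R) < t by [].
  by rewrite modulusE /= expr0n addr0 sqrtr0.
- move=> c z /andP[c0 c1] /= zt.
  rewrite /sublevel /= modulusM modulus_real ger0_norm//; apply: le_lt_trans zt.
  by rewrite ler_piMl// modulus_ge0.
Qed.

Lemma X_sigma_plane (r : R) : 1 <= r ->
  X_sigma (Y := complex_plane R) (@modulus R) r = ln r.
Proof.
move=> r1; rewrite /X_sigma /Rintegral.
rewrite (_ : (\int[_]_(x in _) _)%E = (\int[mu]_(t in `[1%R, r]) (t^-1)%:E)%E).
  by rewrite integral_inv//= ln1 subr0.
apply: eq_integral => t; rewrite inE/= in_itv/= => /andP[t1 _].
by rewrite euler_char_disc ?mul1r// (lt_le_trans ltr01).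
Qed.

End XSigma.

(** * Functions with an almost everywhere vanishing derivative *)

Section AEDerivative.
Context {R : realType}.
Local Notation mu := (@lebesgue_measure R).

Lemma derive1_first_order (g : R -> R) (c e : R) : derivable g c 1 -> 0 < e ->
  exists2 d : R, 0 < d & forall y, `|y - c| < d ->
    `|g y - g c - derive1 g c * (y - c)| <= e * `|y - c|.
Proof.
move=> dg e0.
have : (fun h => h^-1 *: (g (h *: 1 + c) - g c)) @ 0^' --> derive1 g c.
  by rewrite derive1E; exact: dg.
move/cvgrPdist_le => /(_ _ e0) /nbhs_ballP[d /= d0 H].
exists d => // y yc; have [->|ny] := eqVneq y c.
  by rewrite !subrr mulr0 subrr normr0 mulr0.
have h0 : y - c != 0 by rewrite subr_eq0.
have := H (y - c).
rewrite /ball /= sub0r normrN => /(_ yc h0).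
rewrite /GRing.scale /= mulr1 subrK => h.
have -> : g y - g c - derive1 g c * (y - c) = ((y - c)^-1 * (g y - g c) - derive1 g c) * (y - c).
  by field.
by rewrite normrM distrC ler_wpM2r.
Qed.

Section Cover.
Variables (N : set R).
Hypotheses (mN : measurable N) (N0 : mu N = 0).

(* A finite measure of small mass with infinite density at every point of the
   null set N: the sum of the restrictions of mu to shrinking open
   neighbourhoods of N. *)
Lemma null_set_weight (e : R) : 0 < e ->
  exists m : R -> R -> R, [/\
    forall x y z, x <= y -> y <= z -> m x z = m x y + m y z,
    forall x y, 0 <= m x y <= e &
    forall x, N x -> forall K : R, exists2 d : R, 0 < d &
      forall y, x <= y -> y < x + d -> K * (y - x) <= m x y].
Proof.
move=> e0.
have exO (n : nat) : exists U : set R, [/\ open U, N `<=` U &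
    (mu U <= (e / (2 ^ n.+1)%:R)%:E)%E].
  have en : 0 < e / (2 ^ n.+1)%:R by rewrite divr_gt0// ltr0n expn_gt0.
  have [|U [oU NU UN]] := lebesgue_regularity_outer mN _ en.
    by rewrite [X in (X < _)%E]N0.
  exists U; split=> //.
  have mU : measurable U by exact: open_measurable.
  have -> : U = (U `\` N) `|` N by rewrite setUC setDUK.
  apply: le_trans (measureU2 _ _ _) _ => //; first exact: measurableD.
  by rewrite [X in (_ + X <= _)%E]N0 adde0 ltW.
have [W WP] := choice exO.
have mW n : measurable (W n) by have [oO _ _] := WP n; exact: open_measurable.
pose nu := mseries (fun n => mrestr mu (mW n)) 0.
have nuT (A : set R) : measurable A -> (nu A <= e%:E)%E.
  move=> mA; apply: le_trans (epsilon_trick0 xpredT (ltW e0)).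
  apply: lee_nneseries => // n _; have [_ _] := WP n; apply: le_trans.
  rewrite /mrestr; apply: le_measure; rewrite ?inE; [exact: (measurableI _ _ mA (mW
    n))|exact: mW|exact: subIsetr].
have nufin (A : set R) : measurable A -> nu A \is a fin_num.
  move=> /nuT h; rewrite ge0_fin_numE ?measure_ge0//; exact: le_lt_trans h (ltry _).
exists (fun x y => fine (nu `]x, y]%classic)); split.
- move=> x y z xy yz; rewrite -fineD ?nufin//.
  rewrite -measureU//; last first.
    apply/seteqP; split=> // t []; rewrite /= !in_itv/= => /andP[_ h1] /andP[h2 _].
    by have := lt_le_trans h2 h1; rewrite ltxx.
  congr (fine (nu _)); apply/seteqP; split=> t; rewrite /= !in_itv/=.
    by move=> /andP[xt tz]; have [ty|yt] := leP t y; [left|right]; rewrite ?xt ?yt.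
  move=> [/andP[xt ty]|/andP[yt tz]]; first by rewrite xt (le_trans ty).
  by rewrite tz (le_lt_trans xy).
- move=> x y; rewrite fine_ge0 ?measure_ge0//= -lee_fin fineK ?nufin//; exact: nuT.
move=> x Nx K.
have [k Kk] : exists k : nat, K <= k%:R.
  exists (Num.bound `|K|); apply: ltW; apply: le_lt_trans (ler_norm _) _; exact: archi_boundP.
(* The first [k] open sets share a neighbourhood of x, where each of them contributes the whole
   length y - x. *)
have : \forall y \near x, forall n : 'I_k, W n y.
  apply: (@filter_forall _ 'I_k (fun n y => W n y) (nbhs x)) => n; have [oO NO _] := WP n.
  by apply: open_nbhs_nbhs; split=> //; exact: NO.
move=> /nbhs_ballP[d /= d0 H]; exists d => // y xy yd.
apply: (@le_trans _ _ (k%:R * (y - x))); first by rewrite ler_wpM2r// subr_ge0.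
rewrite -lee_fin fineK ?nufin//.
apply: (@le_trans _ _ (\sum_(0 <= n < k) mrestr mu (mW n) `]x, y]%classic)%E); last first.
  exact: nneseries_lim_ge.
rewrite big_mkord (eq_bigr (fun=> (y - x)%:E)).
  by rewrite sumEFin sumr_const card_ord mulr_natl.
move=> n _; rewrite /mrestr setIidl.
  rewrite lebesgue_measure_itv /= lte_fin; move: xy; rewrite le_eqVlt => /predU1P[->|->]//.
  by rewrite ltxx subrr.
move=> t; rewrite /= in_itv/= => /andP[xt ty]; apply: H.
rewrite /ball /= distrC gtr0_norm ?subr_gt0//; lra.
Qed.

End Cover.

(** The bound [P] on the growth of g is propagated from a to b by a supremum argument. Off N the
    zero derivative leaves an error of slope k; at a point of N the weight m has a density larger
    than the derivative of g, whatever its value. *)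
Lemma derivable_ae_le (a b : R) (g : R -> R) (N : set R) : a <= b ->
  (forall t, a <= t <= b -> derivable g t 1) ->
  measurable N -> mu N = 0 ->
  (forall t, a <= t <= b -> ~ N t -> derive1 g t = 0) ->
  g b <= g a.
Proof.
move=> ab dg mN N0 g0; apply/ler_addgt0Pr => e e0.
(* The slope k costs k (b - a) over the interval and the weight m at most k, for a total of e. *)
pose k := e / (b - a + 1).
have ba : 0 < b - a + 1 by lra.
have k0 : 0 < k by rewrite divr_gt0.
have [m [madd mle mdens]] := null_set_weight mN N0 k0.
pose P t := g t - g a <= k * (t - a) + m a t.
pose S := [set t | a <= t <= b /\ forall s, a <= s <= t -> P s].
have Pa : P a by rewrite /P !subrr mulr0 add0r; have /andP[] := mle a a.
have Sa : S a.
  split; first by rewrite lexx.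
  by move=> s /andP[h1 h2]; have -> : s = a by lra.
have ubS : ubound S b by move=> t [/andP[]].
have hS : has_sup S by split; [exists a|exists b].
set c := sup S.
have ac : a <= c by apply: ub_le_sup => //; exists b.
have cb : c <= b by apply: ge_sup => //; exists a.
have Pbelow s : a <= s -> s < c -> P s.
  move=> as_ sc; have [t [_ Pt]] : exists2 t, S t & s < t.
    have [t St] := sup_adherent (ltac:(rewrite subr_gt0; exact: sc) : 0 < c - s) hS.
    by rewrite opprB addrC subrK => st; exists t.
  by move=> st; apply: Pt; rewrite as_ ltW.
(* The bound passes to the limit from the left: g is continuous at c and m a is nondecreasing. *)
have Pc : P c.
  move: ac; rewrite le_eqVlt => /predU1P[<-//|ac'].
  have acb : a <= c <= b by rewrite ltW.
  have [d d0 H] := derive1_first_order (dg c acb) ltr01.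
  apply/ler_addgt0Pr => e' e'0.
  pose L := `|derive1 g c| + 1.
  have L0 : 0 < L by rewrite ltr_wpDl.
  pose h := Num.min (Num.min d (c - a)) (e' / L) / 2.
  have m0 : 0 < Num.min (Num.min d (c - a)) (e' / L).
    by rewrite !lt_min d0 subr_gt0 ac' divr_gt0.
  have h0 : 0 < h by rewrite divr_gt0.
  have [hd hca heL] : [/\ h < d, h < c - a & h < e' / L].
    have : h < Num.min (Num.min d (c - a)) (e' / L) by rewrite /h; lra.
    by rewrite !lt_min => /andP[/andP[]].
  have hL : h * L < e' by rewrite -ltr_pdivlMr.
  have Ps : P (c - h) by apply: Pbelow; lra.
  rewrite /P in Ps *.
  have e1 : c - h - c = - h by ring.
  have := H (c - h); rewrite e1 normrN gtr0_norm// => /(_ hd).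
  rewrite mul1r -normrN => /(le_trans (ler_norm _)).
  have : - (derive1 g c * h) <= `|derive1 g c| * h.
    by rewrite -mulNr -[in leRHS]normrN; apply: ler_wpM2r (ler_norm _); exact: ltW.
  have : derive1 g c * h <= `|derive1 g c| * h.
    by apply: ler_wpM2r (ler_norm _); exact: ltW.
  have mac : m a c = m a (c - h) + m (c - h) c by apply: madd; lra.
  have /andP[] := mle (c - h) c.
  have : 0 <= k * h by rewrite mulr_ge0// ltW.
  move: Ps hL; rewrite mac /L mulrDr mulrN !mulrBr; lra.
have Sc : S c.
  split; first by rewrite ac.
  by move=> s /andP[h1]; rewrite le_eqVlt => /predU1P[->//|]; exact: Pbelow.
have cE : c = b.
  apply/eqP; rewrite eq_le cb leNgt /=; apply/negP => ltcb.
  have acb : a <= c <= b by rewrite ac.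
  have step : exists2 d : R, 0 < d & forall y, c <= y -> y < c + d ->
      g y - g c <= k * (y - c) + m c y.
    have [Nc|Nc] := pselect (N c).
      (* The added 1 absorbs the error of the first-order expansion of g, taken below with tolerance
         1. *)
      have [d1 d10 H1] := mdens _ Nc (derive1 g c + 1).
      have [d2 d20 H2] := derive1_first_order (dg c acb) ltr01.
      exists (Num.min d1 d2); first by rewrite lt_min d10.
      move=> y cy; rewrite -ltrBlDl lt_min => /andP[y1 y2].
      have h1 : (derive1 g c + 1) * (y - c) <= m c y by apply: H1 => //; rewrite -ltrBlDl.
      have yc : 0 <= y - c by rewrite subr_ge0.
      have := H2 y; rewrite (ger0_norm yc) => /(_ y2).
      move/(le_trans (ler_norm _)).
      have : 0 <= k * (y - c) by rewrite mulr_ge0// ltW.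
      move: h1; rewrite mulrDl; lra.
    have [d d0 H] := derive1_first_order (dg c acb) k0.
    exists d => // y cy; rewrite -ltrBlDl => yd.
    have yc : 0 <= y - c by rewrite subr_ge0.
    have := H y; rewrite (ger0_norm yc) g0// mul0r subr0 => /(_ yd).
    move/(le_trans (ler_norm _)); have /andP[] := mle c y; lra.
  have [d d0 H] := step.
  pose y := Num.min b (c + d / 2).
  have yb : y <= b by rewrite ge_min lexx.
  have cy : c < y by rewrite lt_min ltcb/=; lra.
  have yd : y < c + d by rewrite gt_min; apply/orP; right; lra.
  suff : S y by move=> /(ub_le_sup (ex_intro _ b ubS)); rewrite -/c leNgt cy.
  split; first by rewrite yb (le_trans ac) ?ltW.
  move=> s /andP[as_ sy]; have [sc|cs] := leP s c.
    by move: sc; rewrite le_eqVlt => /predU1P[->//|]; exact: Pbelow.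
  have := H s (ltW cs) (le_lt_trans sy yd).
  by move: Pc; rewrite /P (madd a c s ac (ltW cs)); lra.
have [_ /(_ b)] := Sc; rewrite cE lexx ab => /(_ isT).
rewrite /P => h; have /andP[_ mab] := mle a b.
have : k * (b - a + 1) = e by rewrite /k divfK// gt_eqF.
rewrite mulrDr mulr1; lra.
Qed.

Lemma derivable_ae_cst (a b : R) (g : R -> R) (N : set R) : a <= b ->
  (forall t, a <= t <= b -> derivable g t 1) ->
  measurable N -> mu N = 0 ->
  (forall t, a <= t <= b -> ~ N t -> derive1 g t = 0) ->
  g a = g b.
Proof.
move=> ab dg mN N0 g0; apply/eqP; rewrite eq_le (derivable_ae_le ab dg mN N0 g0) andbT.
have dgN t : a <= t <= b -> derivable (fun x => - g x) t 1.
  by move=> /dg h; apply: derivableN.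
rewrite -lerN2; apply: (derivable_ae_le ab dgN mN N0) => t tab Nt.
rewrite derive1E deriveN; last exact: dg.
by rewrite -derive1E g0// oppr0.
Qed.

End AEDerivative.

(** * Complex derivatives *)

Section ComplexDerivative.
Context {R : realType}.
Implicit Types F : CC R -> CC R.
Local Notation Re := (@complex.Re R).
Local Notation Im := (@complex.Im R).
Local Notation mu := (@lebesgue_measure R).

Lemma is_derive_first_order (g : R -> R) (c l : R) :
  (forall e, 0 < e -> exists2 d : R, 0 < d & forall y, `|y - c| < d ->
    `|g y - g c - l * (y - c)| <= e * `|y - c|) ->
  is_derive c 1 g l.
Proof.
move=> H.
have cv : (fun h => h^-1 *: (g (h *: 1 + c) - g c)) @ 0^' --> l.
  apply/cvgrPdist_le => e e0; have [d d0 Hd] := H e e0.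
  apply/nbhs_ballP; exists d => //= h; rewrite /ball /= sub0r normrN => hd h0.
  rewrite /GRing.scale /= mulr1.
  have := Hd (h + c); rewrite addrK => /(_ hd) h1.
  have -> : l - h^-1 * (g (h + c) - g c) = - (h^-1 * (g (h + c) - g c - l * h)).
    by field.
  by rewrite normrN normrM normfV ler_pdivrMl ?normr_gt0// (mulrC `|h|).
apply: DeriveDef; first by apply: cvgP cv.
exact/cvg_lim.
Qed.

Lemma complex_first_order F z (e : R) : derivable F z 1 -> 0 < e ->
  exists2 d : R, 0 < d & forall w, modulus (w - z) < d ->
    modulus (F w - F z - derive1 F z * (w - z)) <= e * modulus (w - z).
Proof.
move=> dF e0.
have dE : derive1 F z = 'D_1 F z by rewrite derive1E.
move: dF; rewrite /derivable; set G := (X in cvg X) => dF.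
have : G --> derive1 F z by rewrite dE; exact: dF.
have e0' : 0 < e%:C by rewrite ltcR.
move/cvgrPdist_le => /(_ _ e0').
move=> /nbhs_modulus[d d0 H].
exists d => // w wz; have [->|nw] := eqVneq w z.
  by rewrite !subrr mulr0 subrr modulusE/= expr0n addr0 sqrtr0 mulr0.
have h0 : w - z != 0 by rewrite subr_eq0.
have := H (w - z); rewrite sub0r modulusN => /(_ wz h0).
rewrite /GRing.scale /= mulr1 subrK norm_modulus lecR => h.
have -> : F w - F z - derive1 F z * (w - z) =
   - ((derive1 F z - (w - z)^-1 * (F w - F z)) * (w - z)).
  by field.
by rewrite modulusN modulusM ler_wpM2r// modulus_ge0.
Qed.

Lemma holomorphic_continuous F z : derivable F z 1 -> {for z, continuous F}.
Proof. by move=> dF; apply/differentiable_continuous/derivable1_diffP. Qed.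

Lemma Re_mul_real (z : CC R) (t : R) : Re (z * t%:C) = Re z * t.
Proof. by case: z => x y /=; rewrite mulr0 subr0. Qed.

Lemma Im_mul_real (z : CC R) (t : R) : Im (z * t%:C) = Im z * t.
Proof. by case: z => x y /=; rewrite mulr0 add0r. Qed.

(** F is differentiated over the complex scalars and the line is parametrized by real ones, so the
    chain rule is carried out on first-order expansions. *)
Lemma is_derive_line F (z a : CC R) (t : R) : derivable F (z + t%:C * a) 1 ->
  is_derive t 1 (fun s => Re (F (z + s%:C * a))) (Re (derive1 F (z + t%:C * a) * a)) /\
  is_derive t 1 (fun s => Im (F (z + s%:C * a))) (Im (derive1 F (z + t%:C * a) * a)).
Proof.
move=> dF.
have main e : 0 < e -> exists2 d : R, 0 < d & forall y, `|y - t| < d ->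
    modulus (F (z + y%:C * a) - F (z + t%:C * a) - derive1 F (z + t%:C * a) * a * (y - t)%:C)
      <= e * `|y - t|.
  (* Dividing by |a| + 1 instead of |a| includes the case a = 0. *)
  move=> e0; have M0 : 0 < modulus a + 1 by rewrite ltr_wpDl// modulus_ge0.
  have [d d0 H] := complex_first_order dF (divr_gt0 e0 M0).
  exists (d / (modulus a + 1)); first exact: divr_gt0.
  move=> y yt.
  have eq1 : z + y%:C * a - (z + t%:C * a) = a * (y - t)%:C.
    by rewrite rmorphB /=; ring.
  have eq2 : modulus (a * (y - t)%:C) <= (modulus a + 1) * `|y - t|.
    by rewrite modulusM modulus_real ler_wpM2r// lerDl.
  have := H (z + y%:C * a); rewrite eq1 mulrA => /(_ _)/le_trans; apply.
    by apply: le_lt_trans eq2 _; rewrite mulrC -ltr_pdivlMr.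
  rewrite -mulrA; apply: ler_wpM2l; first exact: ltW.
  by rewrite ler_pdivrMl.
split; apply: is_derive_first_order => e e0; have [d d0 H] := main e e0; exists d => // y yt.
  apply: le_trans (H y yt); apply: le_trans (Re_le_modulus _).
  by rewrite -Re_mul_real !raddfB.
apply: le_trans (H y yt); apply: le_trans (Im_le_modulus _).
by rewrite -Im_mul_real !raddfB.
Qed.

Lemma derive0_segment F (z w : CC R) :
  (forall t : R, 0 <= t <= 1 -> derivable F (z + t%:C * (w - z)) 1) ->
  (forall t : R, 0 <= t <= 1 -> derive1 F (z + t%:C * (w - z)) = 0) ->
  F w = F z.
Proof.
move=> dF F0.
have dl t (ht : 0 <= t <= 1) := is_derive_line (dF t ht).
have e0 : z + (0 : R)%:C * (w - z) = z by rewrite mul0r addr0.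
have e1 : z + (1 : R)%:C * (w - z) = w by rewrite mul1r addrC subrK.
have m0 : measurable (set0 : set R) by exact: measurable0.
have mu0 : mu set0 = 0 by exact: measure0.
have h1 := derivable_ae_cst (ler01 : 0 <= 1 :> R) (fun t ht => @ex_derive _ _ _ _ _ _ _ (dl
  t ht).1) m0 mu0.
have h2 := derivable_ae_cst (ler01 : 0 <= 1 :> R) (fun t ht => @ex_derive _ _ _ _ _ _ _ (dl
  t ht).2) m0 mu0.
rewrite /= e0 e1 in h1 h2.
apply/eqP; rewrite eq_complex; apply/andP; split; apply/eqP/esym.
  apply: h1 => t ht _; rewrite derive1E (@derive_val _ _ _ _ _ _ _ (dl t ht).1).
  by rewrite F0// mul0r.
apply: h2 => t ht _; rewrite derive1E (@derive_val _ _ _ _ _ _ _ (dl t ht).2).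
by rewrite F0// mul0r.
Qed.

End ComplexDerivative.

(** * Holomorphic functions whose derivative vanishes almost everywhere *)

Section AEHolomorphic.
Context {R : realType}.
Implicit Types F : CC R -> CC R.
Local Notation Re := (@complex.Re R).
Local Notation Im := (@complex.Im R).
Local Notation mu := (@lebesgue_measure R).
Local Notation RR := (measurableTypeR R * measurableTypeR R)%type.

(** The product measure of N is the integral of the measures of its sections; a nonnegative function
    of zero integral vanishes almost everywhere. *)
Lemma null_sections (N : set RR) : measurable N -> (mu \x mu)%E N = 0%E ->
  exists G : set R, [/\ measurable G, mu G = 0 &
    forall x, ~ G x -> mu (xsection N x) = 0].
Proof.
move=> mN N0.
have mf : measurable_fun setT (mu \o xsection N) by exact: measurable_fun_xsection.
have : (\int[mu]_x `|(mu \o xsection N) x| = 0)%E.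
  by rewrite -[RHS]N0; apply: eq_integral => x _; rewrite gee0_abs.
move/(ae_eq_integral_abs _ measurableT mf) => [G [mG G0 sub]].
exists G; split=> // x nG; apply: contrapT => h; apply: nG; apply: sub => /=.
by move=> /(_ I).
Qed.

Lemma dense_conull (G : set R) (x e : R) : measurable G -> mu G = 0 -> 0 < e ->
  exists2 y, ~ G y & `|x - y| < e.
Proof.
move=> mG G0 e0; apply: contrapT => h.
have sub : [set` `]x - e, x + e[%R] `<=` G.
  move=> y; rewrite /= in_itv/= -ltr_distlC => xy; apply: contrapT => nG.
  by apply: h; exists y => //; rewrite distrC.
have : (mu [set` `](x - e)%R, (x + e)%R[] <= mu G)%E.
  by apply: le_measure; rewrite ?inE.
rewrite G0 lebesgue_measure_itv /= lte_fin ifT; last by lra.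
by rewrite -EFinB lee_fin; lra.
Qed.

Lemma derive_ae0_rectangle F (x1 x2 y1 y2 : R) (N : set RR) :
  (forall x y, x1 <= x <= x2 -> y1 <= y <= y2 -> derivable F (x +i* y : CC R) 1) ->
  measurable N -> (mu \x mu)%E N = 0%E ->
  (forall x y, x1 <= x <= x2 -> y1 <= y <= y2 -> ~ N (x, y) ->
     derive1 F (x +i* y : CC R) = 0) ->
  forall x y, x1 < x < x2 -> y1 < y < y2 -> derive1 F (x +i* y : CC R) = 0.
Proof.
move=> dF mN N0 F0.
have [G [mG G0 GN]] := null_sections mN N0.
have lineE (x t : R) : x%:C + t%:C * (0 +i* 1) = x +i* t :> CC R.
  by apply/eqP; rewrite eq_complex /=; apply/andP; split; apply/eqP; ring.
have dl (x t : R) : x1 <= x <= x2 -> y1 <= t <= y2 ->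
    is_derive t 1 (fun s => Re (F (x +i* s))) (Re (derive1 F (x +i* t : CC R) * (0 +i* 1))) /\
    is_derive t 1 (fun s => Im (F (x +i* s))) (Im (derive1 F (x +i* t : CC R) * (0 +i* 1))).
  move=> hx ht; have := @is_derive_line _ F (x%:C) (0 +i* 1) t.
  rewrite !lineE => /(_ (dF _ _ hx ht)).
  by under eq_fun do rewrite lineE; under [in X in _ /\ X]eq_fun do rewrite lineE.
have cst_good (x s t : R) : x1 <= x <= x2 -> y1 <= s -> s <= t -> t <= y2 -> ~ G x ->
    F (x +i* s) = F (x +i* t).
  move=> hx ys st ty nG.
  have ins u : s <= u <= t -> y1 <= u <= y2 by move=> /andP[h1 h2]; lra.
  have mNx : measurable (xsection N x) by exact: measurable_xsection.
  have Nx u : ~ xsection N x u -> ~ N (x, u) by rewrite /xsection /= inE.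
  apply/eqP; rewrite eq_complex; apply/andP; split; apply/eqP.
    apply: (derivable_ae_cst (g := fun s => Re (F (x +i* s))) st _ mNx (GN x nG)) => u hu.
      by have [h _] := dl x u hx (ins _ hu); exact: ex_derive.
    move=> /Nx nN; have [h _] := dl x u hx (ins _ hu).
    by rewrite derive1E (@derive_val _ _ _ _ _ _ _ h) F0 ?ins// mul0r.
  apply: (derivable_ae_cst (g := fun s => Im (F (x +i* s))) st _ mNx (GN x nG)) => u hu.
    by have [_ h] := dl x u hx (ins _ hu); exact: ex_derive.
  move=> /Nx nN; have [_ h] := dl x u hx (ins _ hu).
  by rewrite derive1E (@derive_val _ _ _ _ _ _ _ h) F0 ?ins// mul0r.
have cst_all (x s t : R) : x1 < x < x2 -> y1 < s -> s <= t -> t < y2 ->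
    F (x +i* s) = F (x +i* t).
  move=> hx ys st ty; apply/eqP; rewrite -subr_eq0 -[_ == 0]negbK -modulus_gt0.
  apply/negP => m0; set e := modulus _ in m0.
  have ds : derivable F (x +i* s : CC R) 1 by apply: dF; lra.
  have dt : derivable F (x +i* t : CC R) 1 by apply: dF; lra.
  have e4 : 0 < e / 4 by lra.
  have near_cont (u : R) : derivable F (x +i* u : CC R) 1 ->
      exists2 d : R, 0 < d & forall x', `|x - x'| < d ->
        modulus (F (x +i* u) - F (x' +i* u)) < e / 4.
    move=> /holomorphic_continuous cu.
    have := cu _ (near_modulus (F (x +i* u)) e4).
    move=> /nbhs_modulus[d d0 H]; exists d => // x' xx'; apply: H.
    rewrite (_ : _ - _ = (x - x')%:C) ?modulus_real//.
    by apply/eqP; rewrite eq_complex /= subrr !eqxx.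
  have [d1 d10 H1] := near_cont s ds; have [d2 d20 H2] := near_cont t dt.
  (* The last two radii keep the good abscissa x' inside the rectangle; the first two make F vary by
     less than e / 4 at both heights. *)
  have dd0 : 0 < Num.min (Num.min d1 d2) (Num.min (x - x1) (x2 - x)).
    by rewrite !lt_min d10 d20 !subr_gt0.
  have [x' nG] := dense_conull x mG G0 dd0.
  rewrite !lt_min => /andP[/andP[/H1 h1 /H2 h2] /andP[h3 h4]].
  have hx' : x1 <= x' <= x2.
    by have := ler_norm (x - x'); have := ler_norm (x' - x); rewrite distrC; lra.
  have E' : F (x' +i* s) = F (x' +i* t) by apply: cst_good => //; lra.
  have : e <= e / 4 + e / 4.
    have eE : e = modulus ((F (x +i* s) - F (x' +i* s)) + - (F (x +i* t) - F (x' +i* t))).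
      by rewrite /e E'; congr modulus; ring.
    rewrite [leLHS]eE; apply: le_trans (modulusD _ _) _.
    by rewrite modulusN; apply: lerD; exact: ltW.
  lra.
move=> x y hx hy.
have [h1 h2] : is_derive y 1 (fun s => Re (F (x +i* s))) 0 /\ is_derive y 1 (fun s => Im (F
  (x +i* s))) 0.
  have yI : y \in `]y1, y2[%R by rewrite in_itv.
  have nr : \forall s \near y, F (x +i* y) = F (x +i* s).
    move: (near_in_itvoo yI); apply: filterS => s; rewrite in_itv/= => hs.
    by have [sy|ys] := leP s y; [apply/esym|]; apply: cst_all; lra.
  split.
    have h0 : is_derive y 1 (cst (Re (F (x +i* y))) : R -> R) 0 by exact: is_derive_cst.
    apply: near_eq_is_derive h0.
    by apply: filterS nr => s ->.
  have h0 : is_derive y 1 (cst (Im (F (x +i* y))) : R -> R) 0 by exact: is_derive_cst.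
  apply: near_eq_is_derive h0.
  by apply: filterS nr => s ->.
(* The vertical derivative of F is i F', so its two parts are, up to sign, those of F'. *)
have [||k1 k2] := dl x y; [lra|lra|].
have := @derive_val _ _ _ _ _ _ _ k1; rewrite (@derive_val _ _ _ _ _ _ _ h1).
have := @derive_val _ _ _ _ _ _ _ k2; rewrite (@derive_val _ _ _ _ _ _ _ h2).
case: (derive1 F _) => p q /= e1 e2.
by apply/eqP; rewrite eq_complex /=; apply/andP; split; apply/eqP; lra.
Qed.

End AEHolomorphic.

(** * Measurability in the plane *)

Section PlaneMeasurability.
Context {R : realType}.
Local Notation Re := (@complex.Re R).
Local Notation Im := (@complex.Im R).
Local Notation mu := (@lebesgue_measure R).
Local Notation RR := (measurableTypeR R * measurableTypeR R)%type.

(** An open set is the countable union of the squares with rational centre and half-side that it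
    contains; these are measurable rectangles. *)
Lemma open_measurable_plane (A : set (R * R)) : open A -> measurable (A : set RR).
Proof.
move=> oA.
pose box (q : rat * rat * rat) : set (R * R) :=
  [set` `]ratr q.1.1 - ratr q.2, ratr q.1.1 + ratr q.2[%R] `*`
  [set` `]ratr q.1.2 - ratr q.2, ratr q.1.2 + ratr q.2[%R].
pose F q : set RR := if `[< box q `<=` A >] then box q else set0.
have -> : A = \bigcup_q F q.
  apply/seteqP; split=> [[x y] Axy|p [q _]]; last first.
    by rewrite /F; case: asboolP => // sub; exact: sub.
  have [[B1 B2] /= [/nbhs_ballP[e1 /= e10 H1] /nbhs_ballP[e2 /= e20 H2]] sub] :
    nbhs (x, y) A by exact: open_nbhs_nbhs.
  pose e := Num.min e1 e2; have e0 : 0 < e by rewrite lt_min e10.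
  have [r] := rat_in_itvoo (ltac:(lra) : 0 < e / 2); rewrite in_itv/= => /andP[r0 re].
  have [q1] := rat_in_itvoo (ltac:(lra) : x - ratr r < x + ratr r).
  have [q2] := rat_in_itvoo (ltac:(lra) : y - ratr r < y + ratr r).
  rewrite !in_itv/= => /andP[b1 b2] /andP[a1 a2].
  have [re1 re2] : ratr r < e1 / 2 /\ ratr r < e2 / 2.
    by move: re; rewrite -!ltr_pdivrMr//; rewrite lt_min => /andP[].
  exists (q1, q2, r) => //; rewrite /F; case: asboolP => [_|[]].
    by split; rewrite /= in_itv/=; apply/andP; split; lra.
  move=> [u v] [/=]; rewrite !in_itv/= => /andP[u1 u2] /andP[v1 v2].
  apply: sub; split=> /=; [apply: H1|apply: H2]; rewrite /ball /= ltr_norml; apply/andP; split; lra.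
apply: countable_bigcupT_measurable => // q; rewrite /F; case: asboolP => // _.
exact: measurableX.
Qed.

Lemma continuous_measurable_plane (D : set (R * R)) (f : R * R -> R) : open D ->
  (forall p, D p -> {for p, continuous f}) -> measurable_fun (D : set RR) f.
Proof.
move=> oD cf; apply: (measurability _ (RGenOpens.measurableE R)).
move=> _ [_ [a [b ->] <-]]; apply: open_measurable_plane.
rewrite openE => p [Dp fp].
have h1 : nbhs p D by exact: open_nbhs_nbhs.
have h2 : nbhs p (f @^-1` `]a, b[).
  by apply: cf => //; apply: open_nbhs_nbhs; split => //; exact: interval_open.
exact: filterI.
Qed.

Definition cmeasurable (D : set RR) (f : RR -> CC R) :=
  measurable_fun D (fun p => Re (f p)) /\ measurable_fun D (fun p => Im (f p)).

Lemma cmeasurable_cst D (c : CC R) : cmeasurable D (fun=> c).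
Proof. by split; exact: measurable_cst. Qed.

Lemma cmeasurableD D f g : cmeasurable D f -> cmeasurable D g ->
  cmeasurable D (fun p => f p + g p).
Proof.
move=> [f1 f2] [g1 g2]; split.
  by under eq_fun do rewrite raddfD; exact: measurable_funD.
by under eq_fun do rewrite raddfD; exact: measurable_funD.
Qed.

Lemma cmeasurableM D f g : cmeasurable D f -> cmeasurable D g ->
  cmeasurable D (fun p => f p * g p).
Proof.
move=> [f1 f2] [g1 g2]; split.
  rewrite (_ : (fun p => _) = (fun p => Re (f p) * Re (g p) - Im (f p) * Im (g p))).
    by apply: measurable_funB; apply: measurable_funM.
  by apply/funext => p; case: (f p) (g p) => a b [c d].
rewrite (_ : (fun p => _) = (fun p => Re (f p) * Im (g p) + Im (f p) * Re (g p))).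
  by apply: measurable_funD; apply: measurable_funM.
by apply/funext => p; case: (f p) (g p) => a b [c d].
Qed.

Lemma cmeasurable_conj D f : cmeasurable D f -> cmeasurable D (fun p => conjc (f p)).
Proof.
move=> [f1 f2]; split.
  rewrite (_ : (fun p => _) = (fun p => Re (f p)))//.
  by apply/funext => p; case: (f p).
rewrite (_ : (fun p => _) = (fun p => - Im (f p))); first exact: measurableT_comp.
by apply/funext => p; case: (f p).
Qed.

Lemma cmeasurable_sum D (I : Type) (s : seq I) (f : I -> RR -> CC R) :
  (forall i, cmeasurable D (f i)) -> cmeasurable D (fun p => \sum_(i <- s) f i p).
Proof.
move=> mf; elim: s => [|i s IH].
  by under eq_fun do rewrite big_nil; exact: cmeasurable_cst.
by under eq_fun do rewrite big_cons; apply: cmeasurableD.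
Qed.

Lemma continuous_cmeasurable (D : set (R * R)) (F : CC R -> CC R) : open D ->
  (forall p, D p -> {for (complex_of p : CC R), continuous F}) ->
  cmeasurable D (fun p => F (complex_of p)).
Proof.
move=> oD cF; split; apply: continuous_measurable_plane => // p Dp.
  apply: (@continuous_comp _ _ _ (fun p : R * R => F (complex_of p)) Re); last exact: continuous_Re.
  by apply: (@continuous_comp _ _ _ (fun p : R * R => complex_of p : CC R) F);
    [exact: continuous_complex_of|exact: cF].
apply: (@continuous_comp _ _ _ (fun p : R * R => F (complex_of p)) Im); last exact: continuous_Im.
by apply: (@continuous_comp _ _ _ (fun p : R * R => complex_of p : CC R) F);
    [exact: continuous_complex_of|exact: cF].
Qed.

End PlaneMeasurability.

(** * Measurability of complex derivatives *)

Section DerivativeMeasurability.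
Context {R : realType}.
Local Notation Re := (@complex.Re R).
Local Notation Im := (@complex.Im R).
Local Notation RR := (measurableTypeR R * measurableTypeR R)%type.

Definition rect (x1 x2 y1 y2 : R) : set (R * R) := `]x1, x2[%classic `*` `]y1, y2[%classic.

Lemma open_rect x1 x2 y1 y2 : open (rect x1 x2 y1 y2).
Proof. rewrite openE => -[a b] [/= ha hb]; exists (`]x1, x2[%classic, `]y1, y2[%classic) => //=.
by split; apply: open_nbhs_nbhs; split=> //; exact: interval_open. Qed.

Lemma difference_quotient_cvg (g : R -> R) (l h : R) : 0 < h -> is_derive (0 : R) 1 g l ->
  (fun n => (g (h / n.+1%:R) - g 0) * (n.+1%:R / h)) @ \oo --> l.
Proof.
move=> h0 dg; have g0 : derivable g 0 1 by exact: ex_derive.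
have dl : derive1 g 0 = l by rewrite derive1E (@derive_val _ _ _ _ _ _ _ dg).
apply/cvgrPdist_le => e e0; have [d d0 H] := derive1_first_order g0 e0.
near=> n.
have n0 : 0 < n.+1%:R :> R by rewrite ltr0n.
have y0 : 0 < h / n.+1%:R by rewrite divr_gt0.
have yd : `|h / n.+1%:R - 0| < d.
  rewrite subr0 gtr0_norm// ltr_pdivrMr// mulrC -ltr_pdivrMr//.
  near: n; exists (Num.bound (h / d)) => // n /= hn.
  apply: lt_le_trans (archi_boundP _) _; first by rewrite divr_ge0// ltW.
  by rewrite ler_nat (leq_trans hn).
have := H _ yd; rewrite dl subr0 (gtr0_norm y0) => h1.
have -> : l - (g (h / n.+1%:R) - g 0) * (n.+1%:R / h) =
    - ((g (h / n.+1%:R) - g 0 - l * (h / n.+1%:R)) / (h / n.+1%:R)).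
  by field; rewrite !gt_eqF.
by rewrite normrN normrM normfV (gtr0_norm y0) ler_pdivrMr.
Unshelve. all: by end_near. Qed.

(** Continuity of the derivative would require Cauchy's theory; measurability follows from its being
    the pointwise limit of difference quotients with horizontal steps h / (n + 1). The margin h on
    the right keeps the shifted points where F is derivable. *)
Lemma cmeasurable_derive (F : CC R -> CC R) (x1 x2 y1 y2 h : R) : 0 < h ->
  (forall x y, x1 < x < x2 + h -> y1 < y < y2 -> derivable F (x +i* y : CC R) 1) ->
  cmeasurable (rect x1 x2 y1 y2 : set RR) (fun p => derive1 F (complex_of p)).
Proof.
move=> h0 dF; pose D : set RR := rect x1 x2 y1 y2.
have oD := @open_rect x1 x2 y1 y2.
have hn n : 0 < h / n.+1%:R <= h.
  by rewrite divr_gt0//= ler_pdivrMr// ler_peMr ?ler1n// ltW.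
have inD p : rect x1 x2 y1 y2 p -> x1 < p.1 < x2 /\ y1 < p.2 < y2.
  by case: p => a b [/=]; rewrite !in_itv.
have lineE (p : R * R) (s : R) : complex_of p + s%:C * 1 = (p.1 + s) +i* p.2 :> CC R.
  by rewrite mulr1 /complex_of; apply/eqP; rewrite eq_complex /= addr0 !eqxx.
have cF0 : cmeasurable D (fun p => F (complex_of p)).
  apply: continuous_cmeasurable => // -[a b] /inD[/= ha hb].
  by apply: holomorphic_continuous; apply: (dF a b); lra.
have cFn n : cmeasurable D (fun p => F (complex_of p + (h / n.+1%:R)%:C * 1)).
  apply: (continuous_cmeasurable (F := fun z => F (z + (h / n.+1%:R)%:C * 1))) => // -[a b]
    /inD[/= ha hb].
  apply: (@continuous_comp _ _ _ (fun z : CC R => z + (h / n.+1%:R)%:C * 1) F).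
    by apply: (@cvgD _ (CC R) _ (nbhs (a +i* b : CC R))); [exact: cvg_id|exact: cvg_cst].
  apply: holomorphic_continuous; rewrite (lineE (a, b)).
  have /andP[hn1 hn2] := hn n; move: (h / n.+1%:R) hn1 hn2 => u hn1 hn2.
  by apply: (dF (a + u) b); lra.
have dl (p : R * R) : D p -> derivable F (complex_of p + (0 : R)%:C * 1) 1.
  by case: p => a b /inD[/= ha hb]; rewrite lineE addr0; apply: (dF a b); lra.
have p0 (p : R * R) : complex_of p + (0 : R)%:C * 1 = complex_of p :> CC R.
  by rewrite mul0r addr0.
split.
  apply: (measurable_fun_cvg (h := fun n p =>
    (Re (F (complex_of p + (h / n.+1%:R)%:C * 1)) - Re (F (complex_of p))) * (n.+1%:R / h))).
    move=> n; apply: measurable_funM; last exact: measurable_cst.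
    by apply: measurable_funB; [exact: (cFn n).1|exact: cF0.1].
  move=> p Dp; have [h1 _] := is_derive_line (dl p Dp).
  have := difference_quotient_cvg h0 h1; rewrite /= p0 mulr1; exact.
apply: (measurable_fun_cvg (h := fun n p =>
    (Im (F (complex_of p + (h / n.+1%:R)%:C * 1)) - Im (F (complex_of p))) * (n.+1%:R / h))).
  move=> n; apply: measurable_funM; last exact: measurable_cst.
  by apply: measurable_funB; [exact: (cFn n).2|exact: cF0.2].
move=> p Dp; have [_ h1] := is_derive_line (dl p Dp).
have := difference_quotient_cvg h0 h1; rewrite /= p0 mulr1; exact.
Qed.

End DerivativeMeasurability.

(** * Holomorphic curves in projective space *)

Section Projective.
Context {R : realType} {N : nat}.
Local Notation PN := (projective_space R N).
Local Notation V := 'rV[CC R]_N.+1.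
Implicit Types L M : PN.

Lemma hcoord_neq0 L : hcoord L != 0.
Proof. by rewrite /hcoord vpick0 -dimv_eq0 (eqP (valP L)). Qed.

Lemma hcoord_mem L : hcoord L \in val L.
Proof. exact: memv_pick. Qed.

Lemma line_hcoord L : val L = <[hcoord L]>%VS.
Proof.
apply/esym/eqP; rewrite eqEdim -memvE hcoord_mem (eqP (valP L)) /=.
by rewrite dim_vline hcoord_neq0.
Qed.

Lemma affine_coord_inj i L M : hcoord L ord0 i != 0 -> hcoord M ord0 i != 0 ->
  affine_coord i L = affine_coord i M -> L = M.
Proof.
move=> Li Mi e; apply/val_inj => /=; rewrite !line_hcoord.
have -> : hcoord L = (hcoord L ord0 i / hcoord M ord0 i) *: hcoord M.
  by rewrite -scalerA -/(affine_coord i M) -e scalerA divff// scale1r.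
apply/eqP; rewrite eqEdim -memvE memvZ ?memv_line//=.
by rewrite !dim_vline scaler_eq0 negb_or hcoord_neq0 mulf_neq0 ?invr_neq0.
Qed.

(** This set determines the index chosen by [pullback_density]; where it is constant, so is the
    affine chart. *)
Definition nonzero_coords L : {set 'I_N.+1} := [set i | hcoord L ord0 i != 0].

Lemma affine_coord_neq0 i L : hcoord L ord0 i != 0 -> affine_coord i L != 0.
Proof. by move=> Li; rewrite scaler_eq0 negb_or invr_neq0 ?hcoord_neq0. Qed.

Lemma affine_coordii i L : hcoord L ord0 i != 0 -> affine_coord i L ord0 i = 1.
Proof. by move=> Li; rewrite mxE mulVf. Qed.

Lemma cone_affine_coord (X : set PN) i L : X L -> hcoord L ord0 i != 0 ->
  cone X (affine_coord i L).
Proof.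
move=> XL Li; split; first exact: affine_coord_neq0.
by exists L => //; rewrite memvZ// hcoord_mem.
Qed.

Lemma exists_nonzero_coord L : exists i, hcoord L ord0 i != 0.
Proof.
apply: contrapT => h; have /eqP := hcoord_neq0 L; apply; apply/rowP => i.
by rewrite mxE; apply: contrapT => /eqP hi; apply: h; exists i.
Qed.

Section HolomorphicMap.
Variable f : complex_plane R -> PN.
Hypothesis hf : holomorphic_map f.

Lemma open_affine_preimage i : open (f @^-1` affine_part i).
Proof. by have [] := hf i. Qed.

Lemma affine_derivable i j (z : CC R) : hcoord (f z) ord0 i != 0 ->
  derivable (fun w : CC R => affine_coord i (f w) ord0 j : CC R) z 1.
Proof.
move=> fz; have [_ /(_ 0 j)] := hf i; apply.
by exists z.
Qed.

Lemma affine_continuous i (z : CC R) : hcoord (f z) ord0 i != 0 ->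
  {for z, continuous (fun w : CC R => affine_coord i (f w) : V)}.
Proof.
move=> fz A [P nP PA].
have : nbhs z (fun w : CC R => forall j : 'I_N.+1, P ord0 j (affine_coord i (f w) ord0 j)).
  apply: (@filter_forall _ 'I_N.+1 (fun j (w : CC R) => P ord0 j (affine_coord i (f w) ord0
    j)) (nbhs z)) => j.
  have := holomorphic_continuous (@affine_derivable i j z fz).
  by apply; exact: nP.
by apply: filterS => w Pw; apply: PA => k j; rewrite ord1.
Qed.

(* z0 maximizes the number of nonzero coordinates: nonvanishing is an open
   condition, so no coordinate can appear or disappear near such a point. *)
Lemma exists_generic_coords : exists z0 : CC R,
  forall z, nonzero_coords (f z) = nonzero_coords (f z0) ->
    nbhs z (fun w : CC R => nonzero_coords (f w) = nonzero_coords (f z0)).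
Proof.
pose P n := `[< exists z, #|nonzero_coords (f z)| = n >].
have exP : exists n, P n by exists #|nonzero_coords (f 0)|; apply/asboolP; exists 0.
have ubP n : P n -> (n <= N.+1)%N.
  by move=> /asboolP[z <-]; rewrite -[leqRHS](card_ord N.+1) max_card.
have [n /asboolP[z0 z0n] nmax] := ex_maxnP exP ubP.
exists z0 => z zz0.
have : nbhs z (fun w : CC R => forall i, i \in nonzero_coords (f z0) -> hcoord (f w) ord0 i != 0).
  apply: (@filter_forall _ 'I_N.+1 (fun i (w : CC R) => i \in nonzero_coords (f z0) ->
    hcoord (f w) ord0 i != 0) (nbhs z)) => i.
  have [iz|niz] := boolP (i \in nonzero_coords (f z0)); last by apply: nearW.
  have : nbhs z (f @^-1` affine_part i).
    apply: open_nbhs_nbhs; split; first exact: open_affine_preimage.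
    by move: iz; rewrite -zz0 inE.
  by apply: filterS.
apply: filterS => w Hw; apply/esym/eqP; rewrite eqEcard; apply/andP; split.
  by apply/fintype.subsetP => i /Hw; rewrite inE.
by rewrite z0n; apply: nmax; apply/asboolP; exists w.
Qed.

(** If all derivatives vanished at the points sharing the coordinates of f z0, then f would be
    locally constant there. The set where f = f z0 would be open, and closed by continuity, hence
    the whole plane. *)
Lemma exists_derivative_neq0 (z0 : CC R) :
  (forall z, nonzero_coords (f z) = nonzero_coords (f z0) ->
    nbhs z (fun w : CC R => nonzero_coords (f w) = nonzero_coords (f z0))) ->
  (exists z w, f z <> f w) ->
  forall i, hcoord (f z0) ord0 i != 0 ->
  exists z, nonzero_coords (f z) = nonzero_coords (f z0) /\
  exists j, derive1 (fun w : CC R => affine_coord i (f w) ord0 j : CC R) z != 0.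
Proof.
move=> gen nc i iz0; apply: contrapT => nex.
have iU z : nonzero_coords (f z) = nonzero_coords (f z0) -> hcoord (f z) ord0 i != 0.
  by move=> /setP/(_ i); rewrite !inE iz0.
have d0 z j : nonzero_coords (f z) = nonzero_coords (f z0) ->
    derive1 (fun w : CC R => affine_coord i (f w) ord0 j : CC R) z = 0.
  move=> hz; apply: contrapT => /eqP h; apply: nex; exists z; split=> //.
  by exists j.
have loc z : nonzero_coords (f z) = nonzero_coords (f z0) ->
    nbhs z (fun w : CC R => f w = f z).
  move=> hz; have [e e0 He] := nbhs_modulus (gen _ hz).
  apply: filterS (near_modulus z e0) => w zw.
  have seg (t : R) : 0 <= t <= 1 -> nonzero_coords (f (z + t%:C * (w - z))) = nonzero_coords (f z0).
    move=> /andP[t0 t1]; apply: He.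
    rewrite opprD addrA subrr add0r modulusN modulusM modulus_real ger0_norm//.
    apply: le_lt_trans zw; rewrite -[z - w]opprB modulusN ler_piMl// modulus_ge0//.
  apply: (affine_coord_inj (i := i)); [apply: iU; exact: He|exact: iU|].
  apply/rowP => j.
  apply: (derive0_segment (F := fun w : CC R => affine_coord i (f w) ord0 j)) => t ht.
    by apply: affine_derivable; apply: iU; exact: seg.
  by apply: d0; exact: seg.
have B : [set z : CC R | f z = f z0] = setT.
  apply: (@plane_connected R); first by exists z0.
    exists [set z : CC R | f z = f z0]; last by rewrite setTI.
    rewrite openE => z /= zz0; have := loc z; rewrite zz0 => /(_ erefl).
    by apply: filterS.
  exists [set z : CC R | f z = f z0]; last by rewrite setTI.
  (* Closedness is tested in an affine chart k around f z, since the i-th coordinate is not yet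
     known to be nonzero at the limit point. *)
  move=> z clz; have [k kz] := exists_nonzero_coord (f z).
  have nk : nbhs z (f @^-1` affine_part k).
    by apply: open_nbhs_nbhs; split; [exact: open_affine_preimage|].
  have [w [/= wz0 kw]] := clz _ nk.
  have kz0 : hcoord (f z0) ord0 k != 0 by rewrite -wz0.
  suff h : affine_coord k (f z) = affine_coord k (f z0) by exact: (affine_coord_inj kz kz0 h).
  apply/rowP => j.
  apply: contrapT => /eqP ne.
  have cj := holomorphic_continuous (@affine_derivable k j z kz).
  have nj : nbhs z (fun w : CC R => affine_coord k (f w) ord0 j != affine_coord k (f z0) ord0 j).
    pose c : CC R := affine_coord k (f z0) ord0 j.
    by apply: (cj [set x | x != c]); apply: open_nbhs_nbhs; split=> //; exact: open_neq_plane.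
  by have [w' [/= w'z0]] := clz _ nj; rewrite w'z0 eqxx.
have [z [w zw]] := nc; apply: zw.
have Bz x : f x = f z0 by have : [set z : CC R | f z = f z0] x by rewrite B.
by rewrite !Bz.
Qed.

End HolomorphicMap.
End Projective.

Lemma cvg_ReIm (R : realType) (T : Type) (F : set_system T) {FF : Filter F}
    (g : T -> CC R) (l : CC R) :
  complex.Re (g x) @[x --> F] --> complex.Re l ->
  complex.Im (g x) @[x --> F] --> complex.Im l -> g @ F --> l.
Proof.
move=> h1 h2; have := cvg_complex h1 h2.
have -> : (fun x => complex.Re (g x) +i* complex.Im (g x)) = g.
  by apply/funext => x; case: (g x).
by case: l h1 h2 => a b h1 h2; exact.
Qed.

(** * The density of the pulled back form in a fixed affine chart *)

Section PullbackDensity.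
Context {R : realType} {N : nat}.
Local Notation PN := (projective_space R N).
Local Notation V := 'rV[CC R]_N.+1.
Local Notation Re := (@complex.Re R).
Local Notation Im := (@complex.Im R).
Local Notation mu := (@lebesgue_measure R).
Local Notation RR := (measurableTypeR R * measurableTypeR R)%type.

Variables (X : set PN) (H : V -> 'M[R[i]]_N.+1).
Hypothesis posH : positive_form X H.
Variable f : complex_plane R -> PN.
Hypothesis hf : holomorphic_map f.
Hypothesis fX : forall z, X (f z).

Let F (i j : 'I_N.+1) (w : CC R) : CC R := affine_coord i (f w) ord0 j.

Let dF (i : 'I_N.+1) (z : CC R) : V := \row_j derive1 (F i j) z.

(** [pullback_density] with the affine chart i frozen; [pullback_densityE] identifies the two at the
    points where i is the chosen index. *)
Let density (i : 'I_N.+1) (z : CC R) : R :=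
  Re ((dF i z *m H (affine_coord i (f z)) *m conj_tr (dF i z)) ord0 ord0).

(** H is controlled only on the cone of X. The lifted curve stays in that cone, where H agrees with
    a local smooth extension G whose continuity passes to the composite. *)
Lemma form_continuous i j k (z : CC R) : hcoord (f z) ord0 i != 0 ->
  {for z, continuous (fun w : CC R => H (affine_coord i (f w)) j k : CC R)}.
Proof.
move=> fz.
have cz := cone_affine_coord (fX z) fz.
have [_ _ _ _ [W [G [oW Wz smG GH]]]] := posH cz.
have ca := affine_continuous hf fz.
have n1 : nbhs z (fun w : CC R => W (affine_coord i (f w))).
  by apply: ca; exact: open_nbhs_nbhs.
have n2 : nbhs z (fun w : CC R => hcoord (f w) ord0 i != 0).
  have := @open_nbhs_nbhs _ z (f @^-1` affine_part i); apply.
  by split; [exact: open_affine_preimage|].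
have near_eq : nbhs z (fun w : CC R => G (affine_coord i (f w)) j k = H (affine_coord i (f w)) j k).
  have sub w : W (affine_coord i (f w)) -> hcoord (f w) ord0 i != 0 ->
      G (affine_coord i (f w)) j k = H (affine_coord i (f w)) j k.
    by move=> Ww fw; have e := GH _ Ww (cone_affine_coord (fX w) fw); rewrite e.
  by apply: filterS2 n1 n2 => w Ww fw; exact: sub.
have [smr smi] := smG j k.
have cr := (smr 0%N).1 _ Wz; have ci := (smi 0%N).1 _ Wz.
have e : G (affine_coord i (f z)) j k = H (affine_coord i (f z)) j k := nbhs_singleton near_eq.
suff : (fun w : CC R => G (affine_coord i (f w)) j k : CC R) @ z --> (G (affine_coord i (f
  z)) j k : CC R).
  rewrite e => h; apply: cvg_trans h; exact: near_eq_cvg near_eq.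
apply: (@cvg_ReIm _ _ (nbhs z)).
  exact: (@continuous_comp _ _ _ (fun w : CC R => affine_coord i (f w) : V) (fun v => Re (G
    v j k)) z ca cr).
exact: (@continuous_comp _ _ _ (fun w : CC R => affine_coord i (f w) : V) (fun v => Im (G v
  j k)) z ca ci).
Qed.

(** The i-th coordinate of the lift is constantly 1 near z, so the derivative of the lift has i-th
    coordinate 0. A radial vector with this property is zero, so a nonzero derivative is not radial
    and positivity of the form applies. *)
Lemma density_ge0 i (z : CC R) : nbhs z (fun w : CC R => hcoord (f w) ord0 i != 0) ->
  0 <= density i z /\ (density i z = 0 -> forall j, derive1 (F i j) z = 0).
Proof.
move=> nz; have fz : hcoord (f z) ord0 i != 0 by exact: (nbhs_singleton nz).
have [_ _ _ pos _] := posH (cone_affine_coord (fX z) fz).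
have dii : derive1 (F i i) z = 0.
  rewrite derive1E (@near_eq_derive _ _ _ (F i i) (cst 1)) ?derive_cst//.
  by apply: filterS nz => w fw; rewrite /F affine_coordii.
have [d0|d0] := eqVneq (dF i z) 0.
  have e : density i z = 0 by rewrite /density d0 !mul0mx mxE.
  rewrite e; split; first exact: lexx.
  move=> _ j; by have := congr1 (fun v : V => v ord0 j) d0; rewrite !mxE.
have notin : dF i z \notin <[affine_coord i (f z)]>%VS.
  apply/negP => /vlineP[c e].
  have := congr1 (fun v : V => v ord0 i) e; rewrite !mxE dii mulVf// mulr1 => c0.
  by move: d0; rewrite e -c0 scale0r eqxx.
have := pos _ notin; rewrite ltcE => /andP[_ p].
have {}p : 0 < density i z := p.
have pn (x : R) : 0 < x -> x = 0 -> False by move=> + x0; rewrite x0 ltxx.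
split; first exact: ltW.
move=> e; exact: (False_ind _ (pn (density i z) p e)).
Qed.

Lemma density_measurable i (x1 x2 y1 y2 h : R) : 0 < h ->
  (forall x y, x1 < x < x2 + h -> y1 < y < y2 -> hcoord (f (x +i* y)) ord0 i != 0) ->
  measurable_fun (rect x1 x2 y1 y2 : set RR) (fun p => density i (complex_of p)).
Proof.
move=> h0 fi.
have inD p : rect x1 x2 y1 y2 p -> x1 < p.1 < x2 /\ y1 < p.2 < y2.
  by case: p => a b [/=]; rewrite !in_itv.
have md j : cmeasurable (rect x1 x2 y1 y2 : set RR) (fun p => derive1 (F i j) (complex_of p)).
  by apply: (cmeasurable_derive h0) => x y hx hy; apply: affine_derivable => //; exact: fi.
have mH j k : cmeasurable (rect x1 x2 y1 y2 : set RR)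
    (fun p => H (affine_coord i (f (complex_of p))) j k).
  apply: (continuous_cmeasurable (F := fun w : CC R => H (affine_coord i (f w)) j k)).
    exact: open_rect.
  by move=> [a b] /inD[/= ha hb]; apply: form_continuous; apply: (fi a b); lra.
have [] : cmeasurable (rect x1 x2 y1 y2 : set RR) (fun p =>
    \sum_k (\sum_j derive1 (F i j) (complex_of p) * H (affine_coord i (f (complex_of p))) j k) *
       conjc (derive1 (F i k) (complex_of p))); last first.
  move=> + _; apply: eq_measurable_fun => p _; congr Re.
  rewrite mxE; apply: eq_bigr => k _; rewrite !mxE; congr (_ * _).
  by apply: eq_bigr => j _; rewrite !mxE.
apply: cmeasurable_sum => k; apply: cmeasurableM; last exact: cmeasurable_conj.
by apply: cmeasurable_sum => j; exact: cmeasurableM.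
Qed.

Lemma pullback_densityE i (p z : CC R) :
  [pick j | hcoord (f z) ord0 j != 0] = Some i ->
  pullback_density H f p z = density i z.
Proof. by rewrite /pullback_density /= => ->. Qed.

End PullbackDensity.

(** * A positive lower bound for the integral of the pulled back form *)

Section PullbackIntegral.
Context {R : realType} {N : nat}.
Local Notation PN := (projective_space R N).
Local Notation V := 'rV[CC R]_N.+1.
Local Notation mu := (@lebesgue_measure R).
Local Notation RR := (measurableTypeR R * measurableTypeR R)%type.

Lemma integral_gt0_of_nonnull (D : set RR) (g : RR -> R) : measurable D ->
  measurable_fun D g -> (forall p, D p -> 0 <= g p) ->
  (mu \x mu)%E (D `&` [set p | g p != 0]) != 0%E ->
  (0 < \int[(mu \x mu)%E]_(p in D) (g p)%:E)%E.
Proof.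
move=> mD mg g0 nz.
rewrite lt0e integral_ge0 ?andbT; last by move=> p Dp; rewrite lee_fin g0.
apply: contra nz => /eqP i0; apply/eqP.
have mg' : measurable_fun D (fun p => (g p)%:E) by apply/measurable_EFinP.
have : (\int[(mu \x mu)%E]_(p in D) `|(g p)%:E| = 0)%E.
  by rewrite -i0; apply: eq_integral => p; rewrite inE => Dp; rewrite gee0_abs// lee_fin g0.
move/(ae_eq_integral_abs _ mD mg') => [G [mG G0 sub]].
apply: (subset_measure0 _ mG _ G0).
  have -> : D `&` [set p | g p != 0] = D `&` (g @^-1` [set~ 0]).
    by apply/seteqP; split=> p [Dp] /= /eqP h; split => //; apply/eqP.
  by apply: mg => //; apply: measurableC; exact: measurable_set1.
move=> p [Dp gp]; apply: sub => /= h; move/eqP: gp; apply.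
by have [] := h Dp.
Qed.

Variables (X : set PN) (H : V -> 'M[R[i]]_N.+1).
Hypothesis posH : positive_form X H.
Variable f : complex_plane R -> PN.
Hypothesis hf : holomorphic_map f.
Hypothesis fX : forall z, X (f z).

Lemma pullback_integral_ge : (exists z w, f z <> f w) ->
  exists c t0 : R, [/\ 0 < c, 0 < t0 & forall t, t0 <= t ->
    (c%:E <= pullback_integral H f (sublevel (Y := complex_plane R) (@modulus R) t))%E].
Proof.
move=> nc; have [z0 gen] := exists_generic_coords hf.
have [i0 i0z] := exists_nonzero_coord (f z0).
have [i pick_i] : exists i, [pick j | hcoord (f z0) ord0 j != 0] = Some i.
  by case: pickP => [i _|/(_ i0)]; [exists i|rewrite i0z].
have iz0 : hcoord (f z0) ord0 i != 0.
  by move: pick_i; case: pickP => // k hk [<-].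
have [[a b] [z1U [j dj]]] := exists_derivative_neq0 hf gen nc iz0.
have [e e0 He] := nbhs_modulus (gen _ z1U).
(* A point of the square of half-side 2 d is at distance at most 4 d < e from the centre. The square
   [D] itself has half-side d, which leaves room for the difference quotients. *)
pose d := e / 5; have d0 : 0 < d by rewrite divr_gt0.
have inU (x y : R) : `|x - a| <= 2 * d -> `|y - b| <= 2 * d ->
    nonzero_coords (f (x +i* y)) = nonzero_coords (f z0).
  move=> xa yb; apply: He; apply: le_lt_trans (modulus_le _) _ => /=.
  by rewrite distrC [`|b - y|]distrC; rewrite /d in xa yb; lra.
have box (x c : R) : c - 2 * d <= x <= c + 2 * d -> `|x - c| <= 2 * d.
  by move=> h; rewrite ler_norml; lra.
have iU z : nonzero_coords (f z) = nonzero_coords (f z0) -> hcoord (f z) ord0 i != 0.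
  by move=> /setP/(_ i); rewrite !inE iz0.
have pickU z : nonzero_coords (f z) = nonzero_coords (f z0) ->
    [pick j | hcoord (f z) ord0 j != 0] = Some i.
  move=> /setP h; rewrite -pick_i; apply: eq_pick => k.
  by have := h k; rewrite !inE.
pose D : set RR := rect (a - d) (a + d) (b - d) (b + d).
have mD : measurable D by apply: open_measurable_plane; exact: open_rect.
pose rho p := pullback_density H f (0 : CC R) (complex_of p).
have inD p : D p -> nonzero_coords (f (complex_of p)) = nonzero_coords (f z0).
  case: p => x y [/=]; rewrite !in_itv/= => hx hy.
  by apply: (inU x y); apply: box; lra.
have rhoE p : D p -> rho p = complex.Re
    (((\row_j derive1 (fun w : CC R => affine_coord i (f w) ord0 j : CC R) (complex_of p) : V) *m
      H (affine_coord i (f (complex_of p))) *m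
      conj_tr (\row_j derive1 (fun w : CC R => affine_coord i (f w) ord0 j : CC R)
        (complex_of p) : V)) ord0 ord0).
  by move=> Dp; apply: pullback_densityE; apply: pickU; exact: inD.
have mrho : measurable_fun D rho.
  have cond x y : a - d < x < a + d + d -> b - d < y < b + d ->
      hcoord (f (x +i* y)) ord0 i != 0.
    by move=> hx hy; apply: iU; apply: inU; apply: box; lra.
  have m := density_measurable posH hf fX d0 cond.
  by apply: eq_measurable_fun m => p; rewrite inE => Dp; apply/esym; exact: rhoE.
have nearU p : D p -> nbhs (complex_of p : CC R) (fun w : CC R => hcoord (f w) ord0 i != 0).
  by move=> /inD/gen; apply: filterS => w; exact: iU.
have rho0 p : D p -> 0 <= rho p.
  by move=> Dp; rewrite rhoE//; exact: (density_ge0 posH fX (nearU _ Dp)).1.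
have rhoz p : D p -> rho p = 0 ->
    derive1 (fun w : CC R => affine_coord i (f w) ord0 j : CC R) (complex_of p) = 0.
  by move=> Dp; rewrite rhoE// => r0; exact: (density_ge0 posH fX (nearU _ Dp)).2 r0 j.
have Ipos : (0 < \int[(mu \x mu)%E]_(p in D) (rho p)%:E)%E.
  apply: integral_gt0_of_nonnull => //; apply/eqP => N0.
  have mN : measurable (D `&` [set p | rho p != 0]).
    have -> : D `&` [set p | rho p != 0] = D `&` (rho @^-1` [set~ 0]).
      by apply/seteqP; split=> p [Dp] /= /eqP h; split => //; apply/eqP.
    by apply: mrho => //; apply: measurableC; exact: measurable_set1.
  have hd : 0 < d / 2 by rewrite divr_gt0.
  (* A null density would make the derivative vanish at the centre (a, b), which was chosen to avoid
     this. Halving the side puts a closed rectangle inside the open square [D]. *)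
  move/negP: dj; apply; apply/eqP.
  apply: (@derive_ae0_rectangle R (fun w : CC R => affine_coord i (f w) ord0 j)
    (a - d / 2) (a + d / 2) (b - d / 2) (b + d / 2) _ _ mN N0); last 2 first.
  - by lra.
  - by lra.
  - by move=> x y hx hy; apply: affine_derivable => //; apply: iU; apply: inU; apply: box; lra.
  move=> x y hx hy nN.
  have Dxy : D (x, y) by split; rewrite /= in_itv/=; lra.
  apply: (rhoz (x, y)) => //; apply: contrapT => /eqP h; exact: nN.
pose I := (\int[(mu \x mu)%E]_(p in D) (rho p)%:E)%E.
(* The integral may be infinite as an extended real, in which case c = 1 will do. *)
have [c c0 cI] : exists2 c : R, 0 < c & (c%:E <= I)%E.
  move: Ipos; rewrite -/I; case: I => [r| |] //=.
    by rewrite lte_fin => r0; exists r.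
  by exists 1; rewrite ?leey.
(* Points of [D] are within 2 d of the centre, so [D] lies in every disc of at least this radius. *)
exists c, (modulus (a +i* b) + 2 * d + 1); split=> //.
  by have := modulus_ge0 (a +i* b); lra.
move=> t t0; apply: (le_trans cI); apply: ereal_sup_ubound.
have bound (x y : R) : a - d < x < a + d -> b - d < y < b + d -> modulus (x +i* y : CC R) < t.
  move=> hx hy.
  have -> : x +i* y = (a +i* b) + ((x - a) +i* (y - b)) :> CC R.
    by apply/eqP; rewrite eq_complex /=; apply/andP; split; apply/eqP; ring.
  apply: le_lt_trans (modulusD _ _) _.
  have h : modulus ((x - a) +i* (y - b) : CC R) <= `|x - a| + `|y - b| by exact: modulus_le.
  have xa : `|x - a| < d by rewrite ltr_norml; lra.
  have yb : `|y - b| < d by rewrite ltr_norml; lra.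
  lra.
exists 1%N, (fun=> (0 : CC R)), (fun=> D); split.
- move=> k; split=> // _ [[x y] Dxy <-]; exists (x +i* y) => //; split=> //.
  by move: Dxy => [/=]; rewrite !in_itv/= => hx hy; exact: bound.
- by apply/trivIsetP => k l _ _; rewrite (ord1 k) (ord1 l) eqxx.
- by rewrite big_ord1.
Qed.

End PullbackIntegral.

(** * Growth of the Nevanlinna functions *)

Section Growth.
Context {R : realType} {N : nat}.
Local Notation mu := (@lebesgue_measure R).

(** The integral of a nonnegative function is a supremum over the simple functions below it, hence
    monotone. It is applied to the integrand of [T_char], whose measurability in t is not
    established. *)
Lemma ge0_le_integral_nonmeasurable d (T : measurableType d)
    (m : {measure set T -> \bar R}) (D : set T) (f g : T -> \bar R) :
  (forall x, D x -> (0 <= f x)%E) -> (forall x, D x -> (f x <= g x)%E) ->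
  (\int[m]_(x in D) f x <= \int[m]_(x in D) g x)%E.
Proof.
move=> f0 fg; have g0 x : D x -> (0 <= g x)%E by move=> Dx; exact: le_trans (f0 _ Dx) (fg _ Dx).
rewrite !ge0_integralE//; apply: ereal_sup_le => _ [h hf <-]; exists h => // x.
apply: le_trans (hf x) _; rewrite /patch; case: ifPn => // /set_mem; exact: fg.
Qed.

Lemma T_char_ge (H : 'rV[CC R]_N.+1 -> 'M[R[i]]_N.+1)
    (f : complex_plane R -> projective_space R N) (c t0 r : R) :
  0 < c -> 1 <= t0 -> t0 <= r ->
  (forall t, t0 <= t ->
    (c%:E <= pullback_integral H f (sublevel (Y := complex_plane R) (@modulus R) t))%E) ->
  ((c * (ln r - ln t0))%:E <= T_char (Y := complex_plane R) (@modulus R) H f r)%E.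
Proof.
move=> c0 t01 t0r PI.
have t00 : 0 < t0 by exact: lt_le_trans t01.
have PI0 B : (0 <= pullback_integral H f B)%E.
  apply: ereal_sup_ubound; exists 0%N, (fun=> (0 : CC R)), (fun=> set0); split.
  - by case.
  - by apply/trivIsetP; case.
  - by rewrite big_ord0.
have inv_ge0 (t : R) : 1 <= t -> 0 <= t^-1 by move=> t1; rewrite invr_ge0 (le_trans ler01).
rewrite /T_char EFinM -(integral_inv t00 t0r) -ge0_integralZl_EFin//; last 3 first.
- by move=> t; rewrite /= in_itv/= => /andP[h _]; rewrite lee_fin inv_ge0// (le_trans t01).
- apply/measurable_EFinP; apply: subspace_continuous_measurable_fun => //.
  apply: continuous_in_subspaceT => t; rewrite inE/= in_itv/= => /andP[h _].
  by apply: inv_continuous; rewrite gt_eqF// (lt_le_trans t00).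
- exact: ltW.
have -> : `[t0, r]%classic = `[1, r]%classic `&` `[t0, r]%classic :> set R.
  apply/seteqP; split=> t; rewrite /= !in_itv/=; last by case.
  by move=> /andP[h1 h2]; rewrite h1 h2 (le_trans t01 h1).
rewrite integral_mkcondr; apply: ge0_le_integral_nonmeasurable => t /=; rewrite in_itv/= =>
  /andP[t1 tr].
  rewrite /patch; case: ifP => // _.
  by rewrite -EFinM lee_fin mulr_ge0 ?inv_ge0// ltW.
rewrite /patch; case: ifPn => [/set_mem|_]; last first.
  by rewrite mule_ge0// lee_fin inv_ge0.
rewrite /= in_itv/= => /andP[tt0 _].
by apply: lee_wpmul2r; [rewrite lee_fin inv_ge0|exact: PI].
Qed.

Lemma N_trunc0 (f : complex_plane R -> projective_space R N) (S : set (projective_space R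
  N)) (r : R) :
  (forall z, ~ S (f z)) ->
  N_trunc (Y := complex_plane R) (@modulus R) f S r = 0%E.
Proof.
move=> fS; rewrite /N_trunc; apply: integral0_eq => t _.
have -> : f @^-1` S = set0 by apply/seteqP; split=> // z /fS.
by rewrite set0I /counting; case: asboolP => [_|[]//]; rewrite fset_set0 mul0e.
Qed.

(** Otherwise the set would contain intervals of arbitrarily large length. *)
Lemma unbounded_conull (exc : set R) (r0 : R) : measurable exc -> (mu exc < +oo)%E ->
  exists2 r, r0 <= r & ~ exc r.
Proof.
move=> mexc fin; apply: contrapT => h.
have sub (M : R) : [set` `[r0, r0 + M]%R] `<=` exc.
  move=> r; rewrite /= in_itv/= => /andP[rr _]; apply: contrapT => nr.
  by apply: h; exists r.
have [m mE] : exists m : R, mu exc = m%:E.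
  by exists (fine (mu exc)); rewrite fineK// ge0_fin_numE// measure_ge0.
have m0 : 0 <= m by rewrite -lee_fin -mE measure_ge0.
have : (mu [set` `[r0, (r0 + (m + 1))%R]] <= mu exc)%E.
  by apply: le_measure; rewrite ?inE//; exact: sub.
rewrite mE lebesgue_measure_itv /= lte_fin ifT; last by lra.
by rewrite -EFinB lee_fin; lra.
Qed.

End Growth.

Theorem mainTheorem7 (R : realType) (N : nat) (X : set (projective_space R N))
    (D : effective_cartier X) (xi : field_choice R)
    (X_variety : projective_variety X) (xi_adm : admissible_choice xi)
    (XD_nevanlinna : nevanlinna_pair xi D) :
  brody_hyperbolic (X `\` div_support D)%classic.
Proof.
move=> f hf fXD z w; apply: contrapT => zw.
have [H [posH nev]] := XD_nevanlinna.
have fX y : X (f y) by have [] := fXD y.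
have fD y : ~ div_support D (f y) by have [] := fXD y.
have [c [t0 [c0 t00 PI]]] : exists c t0 : R, [/\ 0 < c, 0 < t0 & forall t, t0 <= t ->
    (c%:E <= pullback_integral H f (sublevel (Y := complex_plane R) (@modulus R) t))%E].
  by apply: (pullback_integral_ge posH hf fX); exists z, w.
(* The integral defining [T_char] starts at 1. *)
pose t1 := Num.max 1 t0.
have t11 : 1 <= t1 by rewrite le_max lexx.
have t10 t : t1 <= t -> t0 <= t by rewrite ge_max => /andP[].
have c20 : 0 < c / 2 by lra.
have [C [exc [mexc finexc ineq]]] := nev _ _ (parabolic_plane) f hf fX (fun h => fD 0 (h 0)) _ c20.
(* [K] gathers the constants: what is lost in T below [t1], the bound of [E_sigma], and the O(1).
   The inequality will read (c / 2) ln r <= K, and r is taken so that (c / 2) ln r >= K + c / 2. *)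
pose K := c * ln t1 + ln 4 / 2 + C.
have [r rbig nexc] := unbounded_conull (Num.max t1 (expR (2 * K / c + 1))) mexc finexc.
move: rbig; rewrite ge_max => /andP[t1r er].
have r1 : 1 <= r by exact: le_trans t1r.
have r0 : 0 < r by exact: lt_le_trans r1.
have lnr : 2 * K / c + 1 <= ln r by rewrite -[leLHS]expRK ler_ln ?posrE ?expR_gt0.
have lnr0 : 0 <= ln r by exact: ln_ge0.
have := ineq r r0 nexc.
have PI1 t : t1 <= t -> (c%:E <= pullback_integral H f (sublevel (Y := complex_plane R)
  (@modulus R) t))%E.
  by move=> /t10; exact: PI.
have := T_char_ge c0 t11 t1r PI1.
move=> /le_trans h /h; rewrite N_trunc0// add0e X_sigma_plane//.
have := E_sigma_plane_le (xi := xi (complex_plane R) (@modulus R)) xi_adm.2 r0.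
have vs := @varsigma_plane_le R.
(* The value +oo contradicts the upper bound, and -oo would make the right-hand side -oo. *)
case: (E_sigma _ _ _) => [E| |] //=.
rewrite !lee_fin => Ele ineq2.
(* As 2 [varsigma] is at most 1, its term is compensated by - [X_sigma] = - ln r. *)
have : (c / 2 + 2 * varsigma (Y := complex_plane R) (@modulus R)) * ln r <= (c / 2 + 1) * ln r.
  by apply: ler_wpM2r => //; lra.
have : (2 * K / c + 1) * (c / 2) <= ln r * (c / 2) by apply: ler_wpM2r => //; exact: ltW.
have -> : (2 * K / c + 1) * (c / 2) = K + c / 2 by field; rewrite gt_eqF.
rewrite /K; move: ineq2; rewrite mulrBr !mulrDl mul1r; lra.
Qed.
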